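(* Let $D=\{(x_1,x_2)\in\mathbb{R}^2 : x_1^2+x_2^2\le 1\}$ and let $\mathbb{B}^4\subset\mathbb{R}^4=\mathbb{C}^2$ be the closed unit ball with boundary $\mathbb{S}^3$. Let $\iota:D\to\mathbb{B}^4$ be a (possibly branched) minimal Lagrangian immersion with $\iota(\partial D)\subset\mathbb{S}^3$ and with Legendrian capillary boundary on $\mathbb{S}^3$. Then $\iota(D)$ is an equatorial plane disk, i.e. $\iota(D)=P\cap\mathbb{B}^4$ for some $2$-dimensional linear subspace $P\subset\mathbb{R}^4$.
   Context: $\mathbb{C}^2=\mathbb{R}^4$ carries the standard Euclidean metric $\langle\cdot,\cdot\rangle$, standard symplectic form $\omega_0=\sum_{i=1}^2 dx_i\wedge dy_i$ and standard complex structure $J(x_1,x_2,y_1,y_2)=(-y_1,-y_2,x_1,x_2)$. A branched minimal immersion of $D$ is a non-constant weakly conformal harmonic map, smooth up to the boundary, which is an immersion away from isolated branch points; ''(branched)'' means that branch points are allowed but need not exist. Geometric conditions (tangent spaces, conormal, etc.) are understood at points where the map is an immersion. $\iota$ is Lagrangian if $\iota^*\omega_0=0$. Let $N$ be the outward unit normal of $\mathbb{S}^3$ (so $N$ at $x\in\mathbb{S}^3$ is $x$). With $\Sigma=\iota(D)$ and $\partial\Sigma=\iota(\partial D)$, the boundary is Legendrian if $JN\perp T\partial\Sigma$ along $\partial\Sigma$. In that case the outward unit conormal $\mu$ of $\partial\Sigma$ in $\Sigma$ can be written $\mu=\sin\theta\,N+\cos\theta\,JN$ with an angle function $\theta\in[0,\pi)$,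 called the contact angle. The boundary is called Legendrian capillary if it is Legendrian and the contact angle $\theta$ is constant (an arbitrary constant is allowed; $\theta\equiv\pi/2$ is the free boundary case). *)

(* Defs.v *)
From mathcomp Require Import all_boot all_order all_algebra.
From mathcomp Require Import all_classical all_reals all_analysis.
Set Implicit Arguments.
Unset Strict Implicit.
Unset Printing Implicit Defensive.
Import Order.TTheory GRing.Theory Num.Theory.
Import numFieldNormedType.Exports.
Local Open Scope classical_set_scope.
Local Open Scope ring_scope.

(* The library norm on row vectors is the sup norm, so all Euclidean notions
   go through this inner product. *)
Definition dot (R : realType) (n : nat) (u v : 'rV[R]_n) : R :=
  \sum_(i < n) u 0 i * v 0 i.

Definition cball (R : realType) (n : nat) : set 'rV[R]_n :=
  [set x | dot x x <= 1].

Definition oball (R : realType) (n : nat) : set 'rV[R]_n :=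
  [set x | dot x x < 1].

Definition usphere (R : realType) (n : nat) : set 'rV[R]_n :=
  [set x | dot x x = 1].

Arguments cball R n : clear implicits.
Arguments oball R n : clear implicits.
Arguments usphere R n : clear implicits.

(* C^2 = R^4 in the coordinates (x1, x2, y1, y2): [lsubmx] is (x1, x2) and
   [rsubmx] is (y1, y2). *)
Definition Jstd (R : realType) (u : 'rV[R]_(2 + 2)) : 'rV[R]_(2 + 2) :=
  row_mx (- rsubmx u) (lsubmx u).

Definition omega0 (R : realType) (u v : 'rV[R]_(2 + 2)) : R :=
  \sum_(i < 2) (lsubmx u 0 i * rsubmx v 0 i - rsubmx u 0 i * lsubmx v 0 i).

Section MapsOfTheDisk.
Variables (R : realType) (m : nat).
Implicit Types (f : 'rV[R]_2 -> 'rV[R]_m.+1) (p u v w : 'rV[R]_2).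

Definition partial (i : 'I_2) f : 'rV[R]_2 -> 'rV[R]_m.+1 :=
  fun p => 'D_(delta_mx 0 i) f p.

Definition smooth_on (U : set 'rV[R]_2) f : Prop :=
  forall (s : seq 'I_2) p, U p -> differentiable (foldr partial f s) p.

(* A map of the closed disk is represented by a total function whose values
   outside [cball R 2] are irrelevant. *)
Definition smooth_up_to_boundary f : Prop :=
  exists (U : set 'rV[R]_2) (F : 'rV[R]_2 -> 'rV[R]_m.+1),
    [/\ open U, cball R 2 `<=` U, smooth_on U F
      & forall p, cball R 2 p -> F p = f p].

(* The differential of f at p applied to v. It is the limit of the differential
   at interior points, so that it is determined by the restriction of f to the
   closed disk also when p is on the boundary; for f smooth up to the boundary
   it is the differential at p of any smooth extension of f. *)
Definition tangent_map f p v : 'rV[R]_m.+1 :=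
  lim ('D_v f q @[q --> within (oball R 2) (nbhs p)]).

Definition harmonic f : Prop :=
  forall p, oball R 2 p -> \sum_(i < 2) partial i (partial i f) p = 0.

Definition weakly_conformal f : Prop :=
  forall p, cball R 2 p -> exists2 lambda : R, 0 <= lambda &
    forall v w, dot (tangent_map f p v) (tangent_map f p w) = lambda * dot v w.

Definition immersed_at f p : Prop := injective (tangent_map f p).

Definition branch_points f : set 'rV[R]_2 :=
  [set p | cball R 2 p /\ ~ immersed_at f p].

Record branched_minimal_immersion f : Prop := {
  bmi_smooth : smooth_up_to_boundary f;
  bmi_nonconstant : exists p q, [/\ cball R 2 p, cball R 2 q & f p <> f q];
  bmi_conformal : weakly_conformal f;
  bmi_harmonic : harmonic f;
  bmi_isolated : branch_points f `<=` isolated (branch_points f) }.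

(* The tangent line of the unit circle at p is { v | dot p v = 0 }, and v points
   strictly out of the disk when 0 < dot p v. *)
Definition outward_unit_conormal f p (mu : 'rV[R]_m.+1) : Prop :=
  [/\ dot mu mu = 1,
      forall v, dot p v = 0 -> dot mu (tangent_map f p v) = 0
    & exists2 v, 0 < dot p v & mu = tangent_map f p v].

End MapsOfTheDisk.

Section Boundary.
Variable R : realType.
Implicit Types f : 'rV[R]_2 -> 'rV[R]_(2 + 2).

Definition lagrangian f : Prop :=
  forall p v w, cball R 2 p ->
    omega0 (tangent_map f p v) (tangent_map f p w) = 0.

(* The outward unit normal N of the unit sphere at f p is f p itself. *)
Definition legendrian_boundary f : Prop :=
  forall p v, usphere R 2 p -> immersed_at f p -> dot p v = 0 ->
    dot (Jstd (f p)) (tangent_map f p v) = 0.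

Definition contact_angle f (p : 'rV[R]_2) (theta : R) : Prop :=
  0 <= theta < pi /\
  outward_unit_conormal f p (sin theta *: f p + cos theta *: Jstd (f p)).

Definition legendrian_capillary_boundary f : Prop :=
  legendrian_boundary f /\
  exists theta : R, forall p, usphere R 2 p -> immersed_at f p ->
    contact_angle f p theta.

End Boundary.

(* Main.v *)
Require Import Defs.
From mathcomp Require Import all_boot all_order all_algebra.
From mathcomp Require Import all_classical all_reals all_analysis.
From mathcomp Require Import ring lra.
Set Implicit Arguments.
Unset Strict Implicit.
Unset Printing Implicit Defensive.
Import Order.TTheory GRing.Theory Num.Theory.
Import numFieldNormedType.Exports.
Local Open Scope classical_set_scope.
Local Open Scope ring_scope.

(** What forces the disk to be flat is that the Liouville form, pulled back to
the disk, vanishes identically.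

Write X and Y for the two coordinate derivatives of the immersion F. The
1-form A dx + B dy with A = omega0 F X and B = omega0 F Y is closed because F
is Lagrangian and coclosed because F is harmonic, so A - i B is holomorphic.
Multiplying by z = x + i y gives a holomorphic function s - i u with
s = x A + y B and u = x B - y A. On the unit circle u is the Liouville form
evaluated on the boundary tangent, which is 0 since the boundary is
Legendrian. By the maximum principle u = 0 on the disk; hence s is constant,
and it vanishes at the origin, so A = B = 0 ([liouville_form_eq0]).

Thus the position vector is symplectically orthogonal to the Lagrangian
tangent plane, that is, tangent to the surface: the surface is a cone.
Differentiating this once more kills the cubic form
(U, V, T) |-> omega0 (D_U V) T, which is the second fundamental form of a
Lagrangian surface ([cone_cubic_form]). The second derivatives of F are then
tangent, and for a fixed vector n the ratio of
<X, n>^2 + <Y, n>^2 to the conformal factor <X, X> has zero gradient away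
from the branch points ([sgrad_normal_ratio]). There are finitely many branch
points, so a generic segment avoids them, and every n normal to the tangent
plane P at one immersed point is normal to all tangent planes; being tangent, the
position vector lies in P everywhere ([position_normal_eq0]).

It remains to see that the image fills the unit disk of P. There F is a
conformal map into a plane disk which sends the circle to the circle. If it
omitted a point q with |q| <= 1, the quotient (1 - |F|^2) / |F - q|^2 would be
subharmonic and zero on the boundary, hence non-positive, so |F| = 1
throughout and F would be degenerate ([omitted_point_degenerate]).

Holomorphy is used only through the Cauchy-Riemann equations of explicit
derivatives, so the analysis reduces to the symmetry of mixed derivatives
([derive_comm]) and to the weak maximum principle ([maximum_principle]), which
follows from the second derivative test. *)

(** * Calculus along lines *)

Section Calculus.
Variables (R : realType) (V : normedModType R).
Implicit Types (f g : V -> R) (p v w : V).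

Lemma is_derive_add f g p v df dg : is_derive p v f df -> is_derive p v g dg ->
  is_derive p v (fun q => f q + g q) (df + dg).
Proof. by move=> Df Dg; exact: is_deriveD. Qed.

Lemma is_derive_sub f g p v df dg : is_derive p v f df -> is_derive p v g dg ->
  is_derive p v (fun q => f q - g q) (df - dg).
Proof. by move=> Df Dg; exact: is_deriveB. Qed.

Lemma is_derive_mul f g p v df dg : is_derive p v f df -> is_derive p v g dg ->
  is_derive p v (fun q => f q * g q) (df * g p + f p * dg).
Proof.
move=> Df Dg; apply: (is_derive_eq (is_deriveM Df Dg)).
by rewrite /GRing.scale /= addrC [g p * _]mulrC.
Qed.

Lemma is_derive_scale c f p v df : is_derive p v f df ->
  is_derive p v (fun q => c * f q) (c * df).
Proof. by move=> Df; exact: is_deriveZ. Qed.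

Lemma is_derive_inv f p v df : f p != 0 -> is_derive p v f df ->
  is_derive p v (fun q => (f q)^-1) (- df / f p ^+ 2).
Proof.
move=> fp0 [Df <-]; constructor; first exact: derivableV.
by rewrite deriveV// /GRing.scale /= mulNr mulrC mulNr.
Qed.

Lemma is_derive_line f p v t df : is_derive (p + t *: v) v f df ->
  is_derive t 1 (fun s => f (p + s *: v)) df.
Proof.
move=> [Df <-]; have E : (fun h : R => h^-1 *: ((f \o shift (p + t *: v)) (h *: v)
    - f (p + t *: v))) = (fun h : R => h^-1 *:
    (((fun s => f (p + s *: v)) \o shift t) (h *: 1) - f (p + t *: v))).
  apply/funext => h /=; congr (_ *: (f _ - _)).
  by rewrite [h *: 1]mulr1 scalerDl addrCA.
by constructor; rewrite /derivable /derive -E.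
Qed.

Lemma is_derive_translate f p v w df : is_derive (p + w) v f df ->
  is_derive p v (fun q => f (q + w)) df.
Proof.
move=> [Df <-]; have E : (fun h : R => h^-1 *: ((f \o shift (p + w)) (h *: v)
    - f (p + w))) = (fun h : R => h^-1 *:
    (((fun q => f (q + w)) \o shift p) (h *: v) - f (p + w))).
  by apply/funext => h /=; rewrite addrA.
by constructor; rewrite /derivable /derive -E.
Qed.

Lemma mean_value_line f df p v (h : R) : 0 < h ->
  (forall t, 0 <= t <= h -> is_derive (p + t *: v) v f (df (p + t *: v))) ->
  exists2 t, 0 < t < h & f (p + h *: v) - f p = h * df (p + t *: v).
Proof.
move=> h0 Df.
pose g (s : R) : R := f (p + s *: v); pose dg (s : R) : R := df (p + s *: v).
have D t : t \in `[0, h]%R -> is_derive t 1 g (dg t).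
  by rewrite in_itv /= => th; exact/is_derive_line/Df.
have C : {within `[0, h], continuous g}.
  by apply: derivable_within_continuous => t /D [].
have D' t : t \in `]0, h[%R -> is_derive t 1 g (dg t).
  by move=> /subset_itv_oo_cc; exact: D.
have [t th E] := @MVT R g dg 0 h h0 D' C.
move: th; rewrite in_itv /= => th; exists t => //.
by move: E; rewrite /g /dg scale0r addr0 subr0 mulrC.
Qed.

(** The second difference over the parallelogram spanned by [h *: a] and
[h *: b] is symmetric in [a] and [b]; reading it as a mixed derivative at an
intermediate point, in either order, is what makes mixed derivatives commute. *)
Lemma mixed_difference f a b p (h : R) : 0 < h ->
  (forall s t, 0 <= s <= h -> 0 <= t <= h ->
    derivable f (p + s *: a + t *: b) a /\
    derivable ('D_a f) (p + s *: a + t *: b) b) ->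
  exists s t, [/\ 0 < s < h, 0 < t < h &
    f (p + h *: a + h *: b) - f (p + h *: a) - (f (p + h *: b) - f p) =
    h ^+ 2 * 'D_b ('D_a f) (p + s *: a + t *: b)].
Proof.
move=> h0 D.
have h00 : (0 : R) <= 0 <= h by apply/andP; split=> //; exact: ltW.
have hh : 0 <= h <= h by apply/andP; split=> //; exact: ltW.
have [t th|s sh E1] := @mean_value_line (fun q => f (q + h *: b) - f q)
    (fun q => 'D_a f (q + h *: b) - 'D_a f q) p a h h0.
  apply: is_derive_sub; last first.
    have [Df _] := D t 0 th h00; apply: derivableP.
    by move: Df; rewrite scale0r addr0.
  have [Df _] := D t h th hh.
  exact/is_derive_translate/derivableP.
have [t th|t th E2] := @mean_value_line ('D_a f) ('D_b ('D_a f)) (p + s *: a) b h h0.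
  have [|_ D2] := D s t _ th; first by case/andP: sh => /ltW -> /ltW ->.
  exact: derivableP.
exists s, t; split => //; rewrite expr2 -mulrA -E2 -E1 -!addrA.
by congr (f _ + _); rewrite addrC.
Qed.

End Calculus.

(** * Symmetry of mixed derivatives *)

Section Clairaut.
Variables (R : realType) (V : normedModType R).
Implicit Types (f : V -> R) (p a b : V).

Lemma dist_half (x y z e : R) :
  `|y - x| < e / 2 -> `|z - x| < e / 2 -> `|y - z| <= e.
Proof. by rewrite !ltr_distl ler_distl => /andP[? ?] /andP[? ?]; lra. Qed.

(** Both mixed derivatives are limits of the same second difference divided by
h^2, so they agree where they are continuous. *)
Lemma derive_comm f a b p :
  (\forall q \near p, [/\ derivable f q a, derivable f q b,
     derivable ('D_a f) q b & derivable ('D_b f) q a]) ->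
  {for p, continuous ('D_b ('D_a f))} -> {for p, continuous ('D_a ('D_b f))} ->
  'D_b ('D_a f) p = 'D_a ('D_b f) p.
Proof.
move=> Df cab cba; apply/eqP; rewrite -subr_eq0 -normr_le0; apply/ler_addgt0Pr => e e0.
rewrite add0r; have e20 : 0 < e / 2 by rewrite divr_gt0.
have P1 : \forall q \near p, `|'D_b ('D_a f) p - 'D_b ('D_a f) q| < e / 2.
  exact: (cvgrPdist_lt _ _).1 cab _ e20.
have P2 : \forall q \near p, `|'D_a ('D_b f) p - 'D_a ('D_b f) q| < e / 2.
  exact: (cvgrPdist_lt _ _).1 cba _ e20.
have P3 : \forall q \near p, [/\ [/\ derivable f q a, derivable f q b,
     derivable ('D_a f) q b & derivable ('D_b f) q a],
     `|'D_b ('D_a f) p - 'D_b ('D_a f) q| < e / 2 &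
     `|'D_a ('D_b f) p - 'D_a ('D_b f) q| < e / 2].
  by apply: filterS3 Df P1 P2 => q.
have /nbhs_ballP[r /= r0 Hr] := P3.
pose K := `|a| + `|b| + 1; have K0 : 0 < K by rewrite ltr_wpDl// addr_ge0.
(* A parallelogram at [p] with sides [h *: a] and [h *: b] stays in the ball. *)
pose h := r / (2 * K); have h0 : 0 < h by rewrite divr_gt0// mulr_gt0.
have near_p s t c d : 0 <= s <= h -> 0 <= t <= h -> `|c| + `|d| + 1 = K ->
    ball p r (p + s *: c + t *: d).
  move=> /andP[s0 sh] /andP[t0 th] E; rewrite -ball_normE /ball_ /= opprD addrA.
  rewrite opprD addrA subrr sub0r -opprD normrN.
  rewrite (le_lt_trans (ler_normD _ _))// !normrZ !ger0_norm//.
  apply: (@le_lt_trans _ _ (h * K)).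
    rewrite -E !mulrDr mulr1 -addrA lerD ?ler_wpM2r//.
    by rewrite -[leLHS]addr0 lerD ?ler_wpM2r// ltW.
  by rewrite /h invfM mulrA divfK ?gt_eqF// ltr_pdivrMr// mulr_natr mulr2n ltrDl.
have Kba : `|b| + `|a| + 1 = K by rewrite [X in X + _]addrC.
have [|s [t [sh th E1]]] := @mixed_difference _ _ f a b p h h0.
  by move=> s t sh th; have [[]] := Hr _ (near_p s t a b sh th erefl).
have [|s' [t' [sh' th' E2]]] := @mixed_difference _ _ f b a p h h0.
  by move=> s' t' sh' th'; have [[]] := Hr _ (near_p s' t' b a sh' th' Kba).
have W x : 0 < x < h -> 0 <= x <= h by move=> /andP[/ltW -> /ltW ->].
have [_ P _] := Hr _ (near_p s t a b (W _ sh) (W _ th) erefl).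
have [_ _ Q] := Hr _ (near_p s' t' b a (W _ sh') (W _ th') Kba).
have {}E1 : 'D_b ('D_a f) (p + s *: a + t *: b) =
    'D_a ('D_b f) (p + s' *: b + t' *: a).
  apply: (@mulfI _ (h ^+ 2)); first by rewrite expf_neq0// gt_eqF.
  apply: etrans (esym E1) _; apply: etrans _ E2; rewrite [X in f X - _]addrAC.
  by move: (f _) (f _) (f _) (f _) => *; ring.
rewrite E1 in P; move: P Q.
exact: dist_half.
Qed.

End Clairaut.

(** * The second derivative test *)

Section SecondDerivativeTest.
Variable R : realType.

(** If [c] were positive, [df] would be positive just to the right of 0, where
it vanishes, and [f] would increase there. *)
Lemma second_derivative_at_max (f df : R -> R) (c d : R) : 0 < d ->
  (forall t : R, `|t| < d -> is_derive t 1 f (df t)) -> is_derive (0 : R) 1 df c ->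
  (forall t : R, `|t| < d -> f t <= f 0) -> c <= 0.
Proof.
move=> d0 Df D2 fmax.
have itvP t : (t \in `]-d, d[%R) = (`|t| < d) by rewrite in_itv /= ltr_norml.
have df0 : df 0 = 0.
  have D0 : is_derive (0 : R) 1 f 0.
    apply: (@derive1_at_max _ f (- d) d) => [|t||t]; rewrite ?itvP ?normr0//.
    - by rewrite ge0_cp// ltW.
    - by move=> /Df [].
    - exact: fmax.
  have := Df 0; rewrite normr0 => /(_ d0) /@derive_val <-.
  exact: derive_val.
rewrite leNgt; apply/negP => c0.
have [/cvgrPdist_lt/(_ c c0) C E] := D2.
move: C; rewrite -[lim _]/(derive _ _ _) E => -[r /= r0 Hr].
pose h := Num.min r d / 2.
have m0 : 0 < Num.min r d by rewrite lt_min r0.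
have h0 : 0 < h by rewrite divr_gt0.
have hm : h < Num.min r d by rewrite ltr_pdivrMr// mulr_natr mulr2n ltrDl.
have [hr hd] : h < r /\ h < d by move: hm; rewrite lt_min => /andP[].
have abs_lt t : 0 <= t <= h -> `|t| < d.
  by move=> /andP[t0 th]; rewrite ger0_norm// (le_lt_trans th).
have [|t th Eh] := @mean_value_line R R^o f df 0 (1 : R^o) h h0.
  by move=> t th; rewrite add0r [_ *: _]mulr1; apply: Df; exact: abs_lt.
move: Eh; rewrite !add0r ![_ *: _]mulr1 => Eh.
have /andP[t0 th'] := th.
have dft : 0 < df t.
  have := Hr t; rewrite /= sub0r normrN (gtr0_norm t0) (lt_trans th' hr) => /(_ isT).
  rewrite gt_eqF// => /(_ isT); rewrite df0 subr0 addr0 [t *: 1]mulr1.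
  rewrite /GRing.scale /= => /(le_lt_trans (ler_norm _)).
  by rewrite ltrBlDr ltrDl pmulr_rgt0// invr_gt0.
have := fmax h; rewrite gtr0_norm// => /(_ hd).
by rewrite -subr_le0 Eh leNgt mulr_gt0.
Qed.

End SecondDerivativeTest.

(** * The Euclidean inner product *)

Section Dot.
Variables (R : realType) (n : nat).
Implicit Types (u v w : 'rV[R]_n).

Lemma dotC u v : dot u v = dot v u.
Proof. by apply: eq_bigr => i _; rewrite mulrC. Qed.

Lemma dotDl u v w : dot (u + v) w = dot u w + dot v w.
Proof. by rewrite -big_split; apply: eq_bigr => i _; rewrite mxE mulrDl. Qed.

Lemma dotZl (c : R) u v : dot (c *: u) v = c * dot u v.
Proof. by rewrite mulr_sumr; apply: eq_bigr => i _; rewrite mxE mulrA. Qed.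

Lemma dotDr u v w : dot w (u + v) = dot w u + dot w v.
Proof. by rewrite !(dotC w) dotDl. Qed.

Lemma dotZr (c : R) u v : dot v (c *: u) = c * dot v u.
Proof. by rewrite !(dotC v) dotZl. Qed.

Lemma dotNl u v : dot (- u) v = - dot u v.
Proof. by rewrite -scaleN1r dotZl mulN1r. Qed.

Lemma dotNr u v : dot u (- v) = - dot u v.
Proof. by rewrite !(dotC u) dotNl. Qed.

Lemma dot0l v : dot 0 v = 0.
Proof. by rewrite -(scale0r 0) dotZl mul0r. Qed.

Lemma dot0r v : dot v 0 = 0.
Proof. by rewrite dotC dot0l. Qed.

Lemma dot_ge0 u : 0 <= dot u u.
Proof. by apply: sumr_ge0 => i _; rewrite -expr2 sqr_ge0. Qed.

Lemma sqr_coord_le_dot u i : u 0 i ^+ 2 <= dot u u.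
Proof.
rewrite /dot (bigD1 i)//= expr2 lerDl; apply: sumr_ge0 => j _.
by rewrite -expr2 sqr_ge0.
Qed.

Lemma dot_eq0 u : (dot u u == 0) = (u == 0).
Proof.
apply/eqP/eqP => [u0|->]; last exact: dot0l.
apply/rowP => i; rewrite mxE; apply/eqP; rewrite -sqrf_eq0.
by rewrite eq_le sqr_ge0 -u0 sqr_coord_le_dot.
Qed.

Lemma dot_deltal i v : dot (delta_mx 0 i) v = v 0 i.
Proof.
rewrite /dot (bigD1 i)//= big1 ?addr0 => [|j ji]; rewrite mxE.
  by rewrite !eqxx mul1r.
by rewrite (negbTE ji) andbF mul0r.
Qed.

End Dot.

Section VectorCalculus.
Variables (R : realType) (V : normedModType R).

Lemma is_derive_coord m n (f : V -> 'M[R]_(m, n)) p v df i j :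
  is_derive p v f df -> is_derive p v (fun q => f q i j) (df i j).
Proof.
move=> [Df <-]; constructor; first exact: (derivable_mxP _ _ _).1.
by rewrite derive_mx// mxE.
Qed.

Lemma is_derive_dot n (f g : V -> 'rV[R]_n) p v df dg :
  is_derive p v f df -> is_derive p v g dg ->
  is_derive p v (fun q => dot (f q) (g q)) (dot df (g p) + dot (f p) dg).
Proof.
move=> Df Dg; rewrite /dot -big_split /=.
rewrite (_ : (fun _ => _) = \sum_(i < n) (fun q => f q 0 i * g q 0 i)); last first.
  by apply/funext => q; rewrite fct_sumE.
by apply: is_derive_sum => i; apply: is_derive_mul; exact: is_derive_coord.
Qed.

Lemma is_derive_omega0 (f g : V -> 'rV[R]_(2 + 2)) p v df dg :
  is_derive p v f df -> is_derive p v g dg ->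
  is_derive p v (fun q => omega0 (f q) (g q)) (omega0 df (g p) + omega0 (f p) dg).
Proof.
move=> Df Dg; rewrite /omega0 -big_split /=.
rewrite (_ : (fun _ => _) = \sum_(i < 2) (fun q => f q 0 (lshift 2 i) * g q 0 (rshift 2 i) -
    f q 0 (rshift 2 i) * g q 0 (lshift 2 i))); last first.
  by apply/funext => q; rewrite fct_sumE; apply: eq_bigr => i _; rewrite !mxE.
apply: is_derive_sum => i; rewrite !mxE.
set c := _ + (_ - _); rewrite (_ : c = df 0 (lshift 2 i) * g p 0 (rshift 2 i) +
    f p 0 (lshift 2 i) * dg 0 (rshift 2 i) - (df 0 (rshift 2 i) * g p 0 (lshift 2 i) +
    f p 0 (rshift 2 i) * dg 0 (lshift 2 i))); last by rewrite /c; ring.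
by apply: is_derive_sub; apply: is_derive_mul; exact: is_derive_coord.
Qed.

End VectorCalculus.

(** * Euclidean balls *)

Section Ball.
Variables (R : realType) (n : nat).

Lemma cvg_coord (T : Type) (F : set_system T) {FF : Filter F} (f : T -> 'rV[R]_n)
    (a : 'rV[R]_n) i :
  f x @[x --> F] --> a -> f x 0 i @[x --> F] --> a 0 i.
Proof.
move=> fa.
exact: (@cvg_comp _ _ _ f (fun y => y 0 i) F _ _ fa (@coord_continuous R 1 n 0 i a)).
Qed.

Lemma cvg_dot (T : Type) (F : set_system T) {FF : Filter F} (f g : T -> 'rV[R]_n)
    (a b : 'rV[R]_n) :
  f x @[x --> F] --> a -> g x @[x --> F] --> b ->
  dot (f x) (g x) @[x --> F] --> dot a b.
Proof.
move=> fa gb; apply: cvg_big => [|i _]; first exact: add_continuous.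

by apply: cvgM; exact: cvg_coord.
Qed.

Lemma continuous_dot : continuous (fun x : 'rV[R]_n => dot x x).
Proof. by move=> x; exact: (@cvg_dot _ (nbhs x) _ id id x x cvg_id cvg_id). Qed.

Lemma open_oball : open (oball R n).
Proof.
exact: (open_comp (D := [set x : R | x < 1]) (fun x _ => @continuous_dot x)
  (@open_lt R 1)).
Qed.

Lemma closed_cball : closed (cball R n).
Proof.
exact: (preimage_closed (D := [set x : R | x <= 1]) (fun x _ => @continuous_dot x)
  (@closed_le R 1)).
Qed.

Lemma oball_cball : oball R n `<=` cball R n.
Proof. by move=> p /ltW. Qed.

Lemma cballE p : cball R n p -> oball R n p \/ usphere R n p.
Proof.
rewrite /cball /oball /usphere /= le_eqVlt => /orP[/eqP|]; by [right|left].
Qed.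

Lemma compact_cball : compact (cball R n).
Proof.
apply: bounded_closed_compact; last exact: closed_cball.
exists 1; split => // M M1 x x1.
have M0 : 0 <= M := ltW (lt_trans ltr01 M1).
rewrite /= [leLHS]/Num.Def.normr/= mx_normrE (bigmax_le _ M0)//= => -[i j] _.
rewrite ord1 /= (le_trans _ (ltW M1))// -(expr_le1 (n := 2))// real_normK ?num_real//.
exact: le_trans (sqr_coord_le_dot _ _) x1.
Qed.

End Ball.

(** * The weak maximum principle *)

Section MaximumPrinciple.
Variables (R : realType) (n : nat).
Local Notation e i := (delta_mx 0 i : 'rV[R]_n.+1).

Lemma oball_line p v : oball R n.+1 p ->
  exists2 d : R, 0 < d & forall t, `|t| < d -> oball R n.+1 (p + t *: v).
Proof.
move=> Bp; have /nbhs_ballP[r /= r0 Hr] := open_nbhs_nbhs (conj (@open_oball R n.+1) Bp).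
have K0 : 0 < `|v| + 1 by rewrite ltr_wpDl.
exists (r / (`|v| + 1)) => [|t]; first by rewrite divr_gt0.
rewrite ltr_pdivlMr// => tr; apply: Hr; rewrite -ball_normE /ball_ /=.
rewrite opprD addrA subrr sub0r normrN normrZ (le_lt_trans _ tr)//.
by rewrite ler_wpM2l// lerDl.
Qed.

(** Adding a small multiple of |p|^2 makes [u] strictly subharmonic. An interior
maximum would then contradict the second derivative test in some coordinate
direction, so the maximum is on the sphere. *)
Lemma maximum_principle (u : 'rV[R]_n.+1 -> R) (du ddu : 'I_n.+1 -> 'rV[R]_n.+1 -> R) :
  {within cball R n.+1, continuous u} ->
  (forall i p, oball R n.+1 p -> is_derive p (e i) u (du i p)) ->
  (forall i p, oball R n.+1 p -> is_derive p (e i) (du i) (ddu i p)) ->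
  (forall p, oball R n.+1 p -> 0 <= \sum_i ddu i p) ->
  (forall p, usphere R n.+1 p -> u p <= 0) ->
  forall p, cball R n.+1 p -> u p <= 0.
Proof.
move=> cu Du DDu lap bd p0 Bp0; rewrite leNgt; apply/negP => u0.
(* With this [c] the value of [w] at [p0] exceeds all its values on the sphere. *)
pose c := u p0 / 2; have c0 : 0 < c by rewrite divr_gt0.
pose w p := u p + c * dot p p.
have cw : {within cball R n.+1, continuous w}.
  move=> x; apply: cvgD; first exact: cu.
  by apply: cvgMr; apply: continuous_subspaceT => ?; exact: continuous_dot.
have [||p /set_mem Bp pmax] := EVT_max_rV _ _ cw.
- by exists p0.
- exact: compact_cball.
have wp0 : u p0 <= w p0 by rewrite /w lerDl mulr_ge0 ?dot_ge0 ?ltW.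
have [Op|Sp] := cballE Bp; last first.
  have := pmax p0 (mem_set Bp0); apply/negP; rewrite -ltNge.
  apply: lt_le_trans wp0; rewrite /w [dot p p]Sp mulr1.
  rewrite (le_lt_trans (lerD (bd _ Sp) (lexx c)))// add0r /c.
  by rewrite ltr_pdivrMr// mulr_natr mulr2n ltrDl.
have H i : ddu i p + 2 * c <= 0.
  have [d d0 Hd] := oball_line (e i) Op.
  have De (q : 'rV[R]_n.+1) : is_derive q (e i) (fun q => dot q q) (2 * q 0 i).
    apply: (is_derive_eq (is_derive_dot (is_derive_id _ _) (is_derive_id _ _))).
    by rewrite [dot q _]dotC dot_deltal; ring.
  apply: (@second_derivative_at_max R (fun t => w (p + t *: e i))
    (fun t => du i (p + t *: e i) + c * (2 * (p + t *: e i) 0 i)) _ d) => //.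
  - move=> t /Hd Bt; apply: (@is_derive_line _ _ w).
    apply: is_derive_add; first exact: Du.
  - apply: (@is_derive_line _ _ (fun q => du i q + c * (2 * q 0 i))).
    rewrite scale0r addr0; apply: is_derive_add; first exact: DDu.
    have Dq : is_derive p (e i) (fun q => 2 * q 0 i) 2.
      have /(is_derive_scale 2) D2 := is_derive_coord 0 i (is_derive_id p (e i)).
      by apply: (is_derive_eq D2); rewrite mxE !eqxx mulr1.
    by apply: (is_derive_eq (is_derive_scale c Dq)); rewrite mulrC.
  - move=> t /Hd Bt; rewrite scale0r addr0; apply: pmax.
    exact/mem_set/oball_cball.
have : \sum_i (ddu i p + 2 * c) <= 0 by apply: sumr_le0 => i _; exact: H.
apply/negP; rewrite -ltNge big_split /= ltr_wpDl//; first exact: lap.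
by rewrite sumr_const card_ord pmulrn_lgt0// mulr_gt0.
Qed.

End MaximumPrinciple.

(** * Partial derivatives of smooth maps of the plane *)

Section SmoothMaps.
Variables (R : realType) (m : nat) (U : set 'rV[R]_2) (F : 'rV[R]_2 -> 'rV[R]_m.+1).
Hypotheses (openU : open U) (smF : smooth_on U F).
Local Notation G s := (foldr (@partial R m) F s).

Lemma rV2E (v : 'rV[R]_2) : v = v 0 0 *: delta_mx 0 0 + v 0 1 *: delta_mx 0 1.
Proof.
rewrite [LHS]row_sum_delta !big_ord_recl big_ord0 addr0.
by have -> : lift ord0 (ord0 : 'I_1) = 1 by exact/val_inj.
Qed.

Lemma derive_partial (g : 'rV[R]_2 -> 'rV[R]_m.+1) p v : differentiable g p ->
  'D_v g p = v 0 0 *: partial 0 g p + v 0 1 *: partial 1 g p.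
Proof.
by move=> dg; rewrite /partial !deriveE// {1}[v]rV2E linearD !linearZ.
Qed.

Lemma is_derive_smooth s p v : U p ->
  is_derive p v (G s) (v 0 0 *: G (0 :: s) p + v 0 1 *: G (1 :: s) p).
Proof.
move=> Up; have dG := smF s Up; rewrite -derive_partial//.
exact/derivableP/diff_derivable.
Qed.

Lemma continuous_smooth s p : U p -> {for p, continuous (G s)}.
Proof. by move=> Up; exact/differentiable_continuous/smF. Qed.

Lemma partial_comm i j s p : U p -> G [:: i, j & s] p = G [:: j, i & s] p.
Proof.
move=> Up; apply/rowP => k.
have nU : \forall q \near p, U q by exact: open_nbhs_nbhs.
pose g q := G s q 0 k.
have dg q v : U q -> is_derive q v g ('D_v (G s) q 0 k).
  move=> Uq; apply: is_derive_coord; exact/derivableP/diff_derivable/smF.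
have ddg q a v : U q -> is_derive q v ('D_(delta_mx 0 a) g) ('D_v (G (a :: s)) q 0 k).
  move=> Uq; apply: (@near_eq_is_derive _ _ _ (fun q => G (a :: s) q 0 k)).
    have nUq : \forall q' \near q, U q' by exact: open_nbhs_nbhs.
    by apply: filterS nUq => q' Uq'; have [_ ->] := dg q' (delta_mx 0 a) Uq'.
  apply: is_derive_coord; exact/derivableP/diff_derivable/smF.
have ddE q a b : U q -> 'D_(delta_mx 0 b) ('D_(delta_mx 0 a) g) q = G [:: b, a & s] q 0 k.
  by move=> Uq; have [_ ->] := ddg q a (delta_mx 0 b) Uq.
have cdd a b : {for p, continuous ('D_(delta_mx 0 b) ('D_(delta_mx 0 a) g))}.
  have E : \forall q \near p,
      G [:: b, a & s] q 0 k = 'D_(delta_mx 0 b) ('D_(delta_mx 0 a) g) q.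
    by apply: filterS nU => q Uq; rewrite ddE.
  apply: cvg_trans (near_eq_cvg E) _; rewrite ddE//.
  apply: cvg_coord; exact: continuous_smooth.
apply: etrans (esym (ddE p j i Up)) _; apply: etrans _ (ddE p i j Up).
apply: (@derive_comm _ _ g (delta_mx 0 j) (delta_mx 0 i) p _ (cdd j i) (cdd i j)).
apply: filterS nU => q Uq; split.
- by have [] := dg q (delta_mx 0 j) Uq.
- by have [] := dg q (delta_mx 0 i) Uq.
- by have [] := ddg q j (delta_mx 0 i) Uq.
- by have [] := ddg q i (delta_mx 0 j) Uq.
Qed.

End SmoothMaps.

(** * The tangent map of a map smooth up to the boundary *)

Section TangentMap.
Variables (R : realType) (m : nat) (U : set 'rV[R]_2).
Variables (f F : 'rV[R]_2 -> 'rV[R]_m.+1).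
Hypotheses (BU : cball R 2 `<=` U) (smF : smooth_on U F).
Hypothesis Ff : forall p, cball R 2 p -> F p = f p.

Lemma closure_oball (p : 'rV[R]_2) : cball R 2 p -> closure (oball R 2) p.
Proof.
move=> Bp A /nbhs_ballP[r /= r0 Hr].
pose t := Num.min 1 (r / (`|p| + 1)) / 2.
have K0 : 0 < `|p| + 1 by rewrite ltr_wpDl.
have m0 : 0 < Num.min 1 (r / (`|p| + 1)) by rewrite lt_min ltr01 divr_gt0.
have t0 : 0 < t by rewrite divr_gt0.
have tm : t < Num.min 1 (r / (`|p| + 1)) by rewrite ltr_pdivrMr// mulr_natr mulr2n ltrDl.
move: tm; rewrite lt_min ltr_pdivlMr// => /andP[t1 tr].
exists ((1 - t) *: p); split.
  rewrite /oball /= dotZl dotZr mulrA -expr2.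
  have t10 : 0 <= 1 - t by rewrite subr_ge0 ltW.
  have : (1 - t) ^+ 2 < 1 by rewrite expr_lt1// ltrBlDr ltrDl.
  by apply: le_lt_trans; rewrite ler_piMr ?sqr_ge0.
apply: Hr; rewrite -ball_normE /ball_ /= scalerBl scale1r opprB addrC subrK.
rewrite normrZ gtr0_norm// (le_lt_trans _ tr)//.
by apply: ler_wpM2l; [exact: ltW|rewrite lerDl].
Qed.

Lemma near_oball p : oball R 2 p -> \forall q \near p, oball R 2 q.
Proof. by move=> Op; apply: open_nbhs_nbhs; split=> //; exact: open_oball. Qed.

(** The limit of the differentials at interior points is the differential of any
smooth extension, by continuity of its partial derivatives. *)
Lemma tangent_mapE p v : cball R 2 p ->
  tangent_map f p v = v 0 0 *: partial 0 F p + v 0 1 *: partial 1 F p.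
Proof.
move=> Bp.
have PF : ProperFilter (within (oball R 2) (nbhs p)).
  exact: within_nbhs_proper (closure_oball Bp).
apply/cvg_lim => //.
have H : v 0 0 *: partial 0 F q + v 0 1 *: partial 1 F q
    @[q --> within (oball R 2) (nbhs p)] --> v 0 0 *: partial 0 F p + v 0 1 *: partial 1 F p.
  apply: cvg_within_filter.
  have c i : {for p, continuous (partial i F)}.
    by have := @continuous_smooth R m U F smF [:: i] p (BU Bp); apply.
  by apply: cvgD; apply: cvgZr; exact: c.
apply: cvg_trans H; apply: near_eq_cvg.
apply: filterS (withinT _ _) => q Oq.
rewrite -derive_partial; last exact/(smF [::])/BU/oball_cball.
apply: near_eq_derive; apply: filterS (near_oball Oq) => q' /oball_cball.
exact: Ff.
Qed.

End TangentMap.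

(** * The symplectic form *)

Section Omega.
Variable R : realType.
Implicit Types u v w : 'rV[R]_(2 + 2).

Lemma omega0C u v : omega0 u v = - omega0 v u.
Proof. by rewrite /omega0 -sumrN; apply: eq_bigr => i _; ring. Qed.

Lemma omega0Dl u v w : omega0 (u + v) w = omega0 u w + omega0 v w.
Proof. by rewrite -big_split; apply: eq_bigr => i _; rewrite !mxE /=; ring. Qed.

Lemma omega0Zl (c : R) u v : omega0 (c *: u) v = c * omega0 u v.
Proof. by rewrite mulr_sumr; apply: eq_bigr => i _; rewrite !mxE /=; ring. Qed.

Lemma omega00l v : omega0 0 v = 0.
Proof. by rewrite -(scale0r 0) omega0Zl mul0r. Qed.

Lemma omega0Dr u v w : omega0 w (u + v) = omega0 w u + omega0 w v.
Proof. by rewrite !(omega0C w) omega0Dl opprD. Qed.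

Lemma omega0Zr (c : R) u v : omega0 v (c *: u) = c * omega0 v u.
Proof. by rewrite !(omega0C v) omega0Zl mulrN. Qed.

Lemma omega0Nr u v : omega0 v (- u) = - omega0 v u.
Proof. by rewrite -scaleN1r omega0Zr mulN1r. Qed.

Lemma omega0vv u : omega0 u u = 0.
Proof. by rewrite /omega0 big1// => i _; ring. Qed.

Lemma omega0E u v : omega0 u v = dot (Jstd u) v.
Proof.
rewrite /omega0 /dot big_split_ord /= -big_split /=; apply: eq_bigr => i _.
by rewrite row_mxEl row_mxEr !mxE; ring.
Qed.

End Omega.

(** * Derivatives of harmonic maps *)

Lemma partial_near (R : realType) m i (f g : 'rV[R]_2 -> 'rV[R]_m.+1) p :
  (\forall q \near p, f q = g q) -> partial i f p = partial i g p.
Proof. exact: near_eq_derive. Qed.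

Lemma partial_opp (R : realType) m i (f : 'rV[R]_2 -> 'rV[R]_m.+1) p :
  derivable f p (delta_mx 0 i) -> partial i (- f) p = - partial i f p.
Proof. exact: deriveN. Qed.

Section HarmonicJet.
Variables (R : realType) (m : nat) (D : set 'rV[R]_2).

Definition is_grad (f : 'rV[R]_2 -> 'rV[R]_m.+1) p (a b : 'rV[R]_m.+1) :=
  forall v : 'rV[R]_2, is_derive p v f (v 0 0 *: a + v 0 1 *: b).

(** The derivatives of a harmonic map up to order three, with all relations
between them built in: 2 F_z = X - i Y is holomorphic, with successive
complex derivatives XX - i XY and Z - i W. The maps are kept abstract so that
only these relations are used. *)
Record harmonic_jet (F X Y XX XY Z W : 'rV[R]_2 -> 'rV[R]_m.+1) : Prop := {
  jet1 : forall p, D p -> is_grad F p (X p) (Y p);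
  jetX : forall p, D p -> is_grad X p (XX p) (XY p);
  jetY : forall p, D p -> is_grad Y p (XY p) (- XX p);
  jetXX : forall p, D p -> is_grad XX p (Z p) (W p);
  jetXY : forall p, D p -> is_grad XY p (W p) (- Z p) }.

End HarmonicJet.

Section SmoothHarmonic.
Variables (R : realType) (m : nat) (U : set 'rV[R]_2) (F : 'rV[R]_2 -> 'rV[R]_m.+1).
Hypotheses (openU : open U) (BU : cball R 2 `<=` U) (smF : smooth_on U F).
Hypothesis harm : forall p, oball R 2 p ->
  partial 0 (partial 0 F) p + partial 1 (partial 1 F) p = 0.

Lemma harmonic_jet_smooth : harmonic_jet (oball R 2) F
  (partial 0 F) (partial 1 F) (partial 0 (partial 0 F)) (partial 1 (partial 0 F))
  (partial 0 (partial 0 (partial 0 F))) (partial 1 (partial 0 (partial 0 F))).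
Proof.
have OU p : oball R 2 p -> U p by move=> /oball_cball /BU.
have YYE p : oball R 2 p -> partial 1 (partial 1 F) p = - partial 0 (partial 0 F) p.
  by move=> /harm/eqP; rewrite addrC addr_eq0 => /eqP.
have YX p : oball R 2 p -> partial 0 (partial 1 F) p = partial 1 (partial 0 F) p.
  by move=> /OU; exact: (partial_comm openU smF 0 1 [::]).
have W0 p : oball R 2 p ->
    partial 0 (partial 1 (partial 0 F)) p = partial 1 (partial 0 (partial 0 F)) p.
  by move=> /OU; exact: (partial_comm openU smF 0 1 [:: 0]).
have W1 p : oball R 2 p ->
    partial 1 (partial 1 (partial 0 F)) p = - partial 0 (partial 0 (partial 0 F)) p.
  move=> Op.
  apply: (@etrans _ _ (partial 1 (partial 0 (partial 1 F)) p)).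
    exact: (@partial_near _ _ 1 _ _ p
      (filterS (fun q Oq => esym (YX q Oq)) (near_oball Op))).
  apply: etrans (partial_comm openU smF 1 0 [:: 1] (OU _ Op)) _.
  apply: (@etrans _ _ (partial 0 (- partial 0 (partial 0 F)) p)).
    exact: (@partial_near _ _ 0 _ _ p (filterS YYE (near_oball Op))).
  apply: partial_opp.
  by have [] := is_derive_smooth smF [:: 0; 0] (delta_mx 0 0) (OU _ Op).
split=> p Op v.
- exact: (is_derive_smooth smF [::] v (OU _ Op)).
- exact: (is_derive_smooth smF [:: 0] v (OU _ Op)).
- apply: (is_derive_eq (is_derive_smooth smF [:: 1] v (OU _ Op))).
  exact: (congr2 (fun a b => v 0 0 *: a + v 0 1 *: b) (YX _ Op) (YYE _ Op)).
- exact: (is_derive_smooth smF [:: 0; 0] v (OU _ Op)).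
- apply: (is_derive_eq (is_derive_smooth smF [:: 1; 0] v (OU _ Op))).
  exact: (congr2 (fun a b => v 0 0 *: a + v 0 1 *: b) (W0 _ Op) (W1 _ Op)).
Qed.

End SmoothHarmonic.

(** * Gradients of scalar functions on the disk *)

Section ScalarGradient.
Variable R : realType.
Implicit Types (f g : 'rV[R]_2 -> R) (p q v : 'rV[R]_2).

Definition is_sgrad f p (a b : R) :=
  forall v : 'rV[R]_2, is_derive p v f (v 0 0 * a + v 0 1 * b).

Lemma sgrad_eq f p a b a' b' : is_sgrad f p a b -> a = a' -> b = b' ->
  is_sgrad f p a' b'.
Proof. by move=> Df <- <-. Qed.

Lemma sgrad_cst (c : R) p : is_sgrad (fun=> c) p 0 0.
Proof. by move=> v; rewrite !mulr0 addr0; exact: is_derive_cst. Qed.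

Lemma sgrad_coord0 p : is_sgrad (fun q => q 0 0) p 1 0.
Proof.
by move=> v; rewrite mulr1 mulr0 addr0; exact: (is_derive_coord 0 0 (is_derive_id p v)).
Qed.

Lemma sgrad_coord1 p : is_sgrad (fun q => q 0 1) p 0 1.
Proof.
by move=> v; rewrite mulr1 mulr0 add0r; exact: (is_derive_coord 0 1 (is_derive_id p v)).
Qed.

Lemma sgrad_add f g p a b c d : is_sgrad f p a b -> is_sgrad g p c d ->
  is_sgrad (fun q => f q + g q) p (a + c) (b + d).
Proof.
by move=> Df Dg v; apply: (is_derive_eq (is_derive_add (Df v) (Dg v))); ring.
Qed.

Lemma sgrad_scale c f p a b : is_sgrad f p a b ->
  is_sgrad (fun q => c * f q) p (c * a) (c * b).
Proof.
by move=> Df v; apply: (is_derive_eq (is_derive_scale c (Df v))); ring.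
Qed.

Lemma sgrad_sub f g p a b c d : is_sgrad f p a b -> is_sgrad g p c d ->
  is_sgrad (fun q => f q - g q) p (a - c) (b - d).
Proof.
by move=> Df Dg v; apply: (is_derive_eq (is_derive_sub (Df v) (Dg v))); ring.
Qed.

Lemma sgrad_mul f g p a b c d : is_sgrad f p a b -> is_sgrad g p c d ->
  is_sgrad (fun q => f q * g q) p (a * g p + f p * c) (b * g p + f p * d).
Proof.
by move=> Df Dg v; apply: (is_derive_eq (is_derive_mul (Df v) (Dg v))); ring.
Qed.

Lemma sgrad_inv f p a b : f p != 0 -> is_sgrad f p a b ->
  is_sgrad (fun q => (f q)^-1) p (- a / f p ^+ 2) (- b / f p ^+ 2).
Proof.
by move=> f0 Df v; apply: (is_derive_eq (is_derive_inv f0 (Df v))); ring.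
Qed.

Lemma sgrad_dot m (f g : 'rV[R]_2 -> 'rV[R]_m.+1) p a b c d :
  is_grad f p a b -> is_grad g p c d ->
  is_sgrad (fun q => dot (f q) (g q)) p
    (dot a (g p) + dot (f p) c) (dot b (g p) + dot (f p) d).
Proof.
move=> Df Dg v; apply: (is_derive_eq (is_derive_dot (Df v) (Dg v))).
by rewrite !(dotDl, dotDr, dotZl, dotZr); ring.
Qed.

Lemma sgrad_omega0 (f g : 'rV[R]_2 -> 'rV[R]_(2 + 2)) p a b c d :
  is_grad f p a b -> is_grad g p c d ->
  is_sgrad (fun q => omega0 (f q) (g q)) p
    (omega0 a (g p) + omega0 (f p) c) (omega0 b (g p) + omega0 (f p) d).
Proof.
move=> Df Dg v; apply: (is_derive_eq (is_derive_omega0 (Df v) (Dg v))).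
by rewrite !(omega0Dl, omega0Dr, omega0Zl, omega0Zr); ring.
Qed.

Lemma grad_cst m (n : 'rV[R]_m.+1) p : is_grad (fun=> n) p 0 0.
Proof. by move=> v; rewrite !scaler0 addr0; exact: is_derive_cst. Qed.

Lemma sgrad_near_cst f p a b c : (\forall q \near p, f q = c) ->
  is_sgrad f p a b -> a = 0 /\ b = 0.
Proof.
move=> fc Df; have H v : v 0 0 * a + v 0 1 * b = 0.
  have [_ <-] := Df v.
  by rewrite (@near_eq_derive _ _ _ f (cst c) p v fc) derive_cst.
have := H (delta_mx 0 0); have := H (delta_mx 0 1).
by rewrite !mxE /= !mul1r !mul0r add0r addr0.
Qed.

Lemma sgrad0_segment f p q :
  (forall t, 0 <= t <= 1 -> is_sgrad f (p + t *: (q - p)) 0 0) -> f q = f p.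
Proof.
move=> Df; have [t th|t _] := @mean_value_line _ _ f (fun=> 0) p (q - p) 1 ltr01.
  by apply: (is_derive_eq (Df t th _)); rewrite !mulr0 addr0.
by rewrite scale1r [p + _]addrC subrK mulr0 => /eqP; rewrite subr_eq0 => /eqP.
Qed.

Lemma oball_segment p q t : oball R 2 p -> oball R 2 q -> 0 <= t <= 1 ->
  oball R 2 (p + t *: (q - p)).
Proof.
rewrite /oball /= => Op Oq /andP[t0 t1].
have := dot_ge0 (p - q).
rewrite !(dotDl, dotDr, dotZl, dotZr, dotNl, dotNr) (dotC q p).
move: Op Oq; move: (dot p p) (dot p q) (dot q q) => a b c a1 c1 H.
have t10 : 0 <= t * (1 - t) by rewrite mulr_ge0// subr_ge0.
have := mulr_ge0 t10 H.
have : (1 - t) * a + t * c < 1.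
  have [->|tn0] := eqVneq t 0; first by rewrite subr0 mul1r mul0r addr0.
  have {tn0} : 0 < t by rewrite lt_neqAle eq_sym tn0.
  by nra.
by nra.
Qed.

Lemma harmonic_maximum_principle (u a b aa ab ba bb : 'rV[R]_2 -> R) :
  {within cball R 2, continuous u} ->
  (forall p, oball R 2 p -> is_sgrad u p (a p) (b p)) ->
  (forall p, oball R 2 p -> is_sgrad a p (aa p) (ab p)) ->
  (forall p, oball R 2 p -> is_sgrad b p (ba p) (bb p)) ->
  (forall p, oball R 2 p -> 0 <= aa p + bb p) ->
  (forall p, usphere R 2 p -> u p <= 0) ->
  forall p, cball R 2 p -> u p <= 0.
Proof.
move=> cu Du Da Db lap bd.
have e1 (i : 'I_2) : i != 0 -> i = 1.
  by case: i => [[|[|]]]//= ? _; exact/val_inj.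
apply: (@maximum_principle _ _ u (fun i => if i == 0 then a else b)
  (fun i => if i == 0 then aa else bb)) => // [i p Op|i p Op|p Op].
- apply: (is_derive_eq (Du p Op _)); have [->|/e1->] := eqVneq i 0;
    by rewrite !mxE /= ?mul1r ?mul0r ?addr0 ?add0r.
- have [->|/e1->] := eqVneq i 0.
    by apply: (is_derive_eq (Da p Op _)); rewrite !mxE /= mul1r mul0r addr0.
  by apply: (is_derive_eq (Db p Op _)); rewrite !mxE /= mul1r mul0r add0r.
- by rewrite !big_ord_recl big_ord0 /= addr0; exact: lap.
Qed.

End ScalarGradient.

(** * Vanishing of the Liouville form *)

Lemma cvg_omega0 (R : realType) (T : Type) (G : set_system T) {FG : Filter G}
    (f g : T -> 'rV[R]_(2 + 2)) (a b : 'rV[R]_(2 + 2)) :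
  f x @[x --> G] --> a -> g x @[x --> G] --> b ->
  omega0 (f x) (g x) @[x --> G] --> omega0 a b.
Proof.
move=> fa gb.
have E (u v : 'rV[R]_(2 + 2)) : omega0 u v = \sum_i (u 0 (lshift 2 i) * v 0 (rshift 2 i)
    - u 0 (rshift 2 i) * v 0 (lshift 2 i)).
  by apply: eq_bigr => i _; rewrite !mxE.
under eq_cvg do rewrite E.
rewrite E; apply: cvg_big => [|i _]; first exact: add_continuous.
by apply: cvgB; apply: cvgM; exact: cvg_coord.
Qed.

Section MinimalLagrangian.
Variables (R : realType) (F X Y XX XY Z W : 'rV[R]_2 -> 'rV[R]_(2 + 2)).
Hypothesis jet : harmonic_jet (oball R 2) F X Y XX XY Z W.
Hypothesis cF : forall p, cball R 2 p -> {for p, continuous F}.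
Hypothesis cX : forall p, cball R 2 p -> {for p, continuous X}.
Hypothesis cY : forall p, cball R 2 p -> {for p, continuous Y}.
Hypothesis lag : forall p, oball R 2 p -> omega0 (X p) (Y p) = 0.
Hypothesis leg : forall p, usphere R 2 p ->
  p 0 0 * omega0 (F p) (Y p) - p 0 1 * omega0 (F p) (X p) = 0.

(** The derivatives of the Lagrangian condition; they express the total symmetry
of the cubic form (U, V, T) |-> omega0 (D_U V) T, combined with harmonicity. *)
Lemma lagrangian_jet p : oball R 2 p ->
  omega0 (Y p) (XX p) = omega0 (X p) (XY p) /\
  omega0 (Y p) (XY p) = - omega0 (X p) (XX p).
Proof.
move=> Op; have := sgrad_near_cst (filterS lag (near_oball Op))
  (sgrad_omega0 (jetX jet Op) (jetY jet Op)).
rewrite omega0Nr (omega0C (XX p)) (omega0C (XY p)) => -[/eqP + /eqP].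
by rewrite addrC subr_eq0 -opprD oppr_eq0 addr_eq0 => /eqP -> /eqP ->.
Qed.

Let A p := omega0 (F p) (X p).
Let B p := omega0 (F p) (Y p).
Let C p := omega0 (F p) (XX p).
Let D p := omega0 (F p) (XY p).

Let dA p : oball R 2 p -> is_sgrad A p (C p) (D p).
Proof.
move=> Op; apply: (sgrad_eq (sgrad_omega0 (jet1 jet Op) (jetX jet Op))).
  by rewrite omega0vv add0r.
by rewrite omega0C lag// oppr0 add0r.
Qed.

Let dB p : oball R 2 p -> is_sgrad B p (D p) (- C p).
Proof.
move=> Op; apply: (sgrad_eq (sgrad_omega0 (jet1 jet Op) (jetY jet Op))).
  by rewrite lag// add0r.
by rewrite omega0vv add0r omega0Nr.
Qed.

Let dC p : oball R 2 p -> is_sgrad C p (omega0 (X p) (XX p) + omega0 (F p) (Z p))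
  (omega0 (X p) (XY p) + omega0 (F p) (W p)).
Proof.
move=> Op; apply: (sgrad_eq (sgrad_omega0 (jet1 jet Op) (jetXX jet Op))) => //.
by have [->] := lagrangian_jet Op.
Qed.

Let dD p : oball R 2 p -> is_sgrad D p (omega0 (X p) (XY p) + omega0 (F p) (W p))
  (- (omega0 (X p) (XX p) + omega0 (F p) (Z p))).
Proof.
move=> Op; apply: (sgrad_eq (sgrad_omega0 (jet1 jet Op) (jetXY jet Op))) => //.
by have [_ ->] := lagrangian_jet Op; rewrite omega0Nr opprD.
Qed.

Let u (p : 'rV[R]_2) := p 0 0 * B p - p 0 1 * A p.

Let du p : oball R 2 p -> is_sgrad u p (B p + p 0 0 * D p - p 0 1 * C p)
  (-1 * (p 0 0 * C p + A p + p 0 1 * D p)).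
Proof.
move=> Op; apply: (sgrad_eq (sgrad_sub (sgrad_mul (sgrad_coord0 p) (dB Op))
  (sgrad_mul (sgrad_coord1 p) (dA Op)))); ring.
Qed.

Let cu : {within cball R 2, continuous u}.
Proof.
apply: continuous_in_subspaceT => p /set_mem Bp.
have c (i : 'I_2) : {for p, continuous (fun q : 'rV[R]_2 => q 0 i)}.
  exact: coord_continuous.
have cA : A q @[q --> p] --> A p by exact: (cvg_omega0 (cF Bp) (cX Bp)).
have cB : B q @[q --> p] --> B p by exact: (cvg_omega0 (cF Bp) (cY Bp)).
exact: (cvgB (cvgM (c 0) cB) (cvgM (c 1) cA)).
Qed.

Let du0 p : oball R 2 p -> is_sgrad (fun q : 'rV[R]_2 => B q + q 0 0 * D q - q 0 1 * C q) p
  (2 * D p + p 0 0 * (omega0 (X p) (XY p) + omega0 (F p) (W p))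
    - p 0 1 * (omega0 (X p) (XX p) + omega0 (F p) (Z p)))
  (- C p - p 0 0 * (omega0 (X p) (XX p) + omega0 (F p) (Z p)) - C p
    - p 0 1 * (omega0 (X p) (XY p) + omega0 (F p) (W p))).
Proof.
move=> Op; apply: (sgrad_eq (sgrad_sub
  (sgrad_add (dB Op) (sgrad_mul (sgrad_coord0 p) (dD Op)))
  (sgrad_mul (sgrad_coord1 p) (dC Op)))); ring.
Qed.

Let du1 p : oball R 2 p ->
  is_sgrad (fun q : 'rV[R]_2 => -1 * (q 0 0 * C q + A q + q 0 1 * D q)) p
  (- C p - p 0 0 * (omega0 (X p) (XX p) + omega0 (F p) (Z p)) - C p
    - p 0 1 * (omega0 (X p) (XY p) + omega0 (F p) (W p)))
  (- p 0 0 * (omega0 (X p) (XY p) + omega0 (F p) (W p)) - D p - D p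
    + p 0 1 * (omega0 (X p) (XX p) + omega0 (F p) (Z p))).
Proof.
move=> Op.
apply: (sgrad_eq (sgrad_scale (-1) (sgrad_add
  (sgrad_add (sgrad_mul (sgrad_coord0 p) (dC Op)) (dA Op))
  (sgrad_mul (sgrad_coord1 p) (dD Op))))); ring.
Qed.

Let u0 p : cball R 2 p -> u p = 0.
Proof.
move=> Bp; apply/eqP; rewrite eq_le; apply/andP; split; move: Bp.
  apply: (harmonic_maximum_principle cu du du0 du1) => [q Oq|q Sq].
    by rewrite le_eqVlt; apply/orP; left; apply/eqP; ring.
  by rewrite le_eqVlt; apply/orP; left; apply/eqP; exact: leg.
move=> Bp; rewrite -oppr_le0 -mulN1r; move: p Bp.
apply: (harmonic_maximum_principle _ (fun p Op => sgrad_scale (-1) (du Op))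
  (fun p Op => sgrad_scale (-1) (du0 Op))
  (fun p Op => sgrad_scale (-1) (du1 Op))) => [|q Oq|q Sq].
- by move=> q; apply: cvgMr; exact: cu.
- by rewrite le_eqVlt; apply/orP; left; apply/eqP; ring.
- by rewrite /u leg// mulr0.
Qed.

(** The holomorphic function (x + i y) (A - i B) = s - i u is real on the circle,
hence constant, hence equal to its value 0 at the origin. *)
Lemma liouville_form_eq0 p : oball R 2 p ->
  omega0 (F p) (X p) = 0 /\ omega0 (F p) (Y p) = 0.
Proof.
pose s (p : 'rV[R]_2) := p 0 0 * A p + p 0 1 * B p.
(* The gradient of [u] vanishes; its components are s_y and - s_x. *)
have gu q : oball R 2 q -> B q + q 0 0 * D q - q 0 1 * C q = 0 /\
    q 0 0 * C q + A q + q 0 1 * D q = 0.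
  move=> Oq; have uz : \forall q' \near q, u q' = 0.
    by apply: filterS (near_oball Oq) => q' /oball_cball; exact: u0.
  have [-> /eqP] := sgrad_near_cst uz (du Oq).
  by rewrite mulN1r oppr_eq0 => /eqP ->.
have ds q : oball R 2 q -> is_sgrad s q 0 0.
  move=> Oq; have [g1 g2] := gu q Oq.
  apply: (sgrad_eq (sgrad_add (sgrad_mul (sgrad_coord0 q) (dA Oq))
    (sgrad_mul (sgrad_coord1 q) (dB Oq)))); [rewrite -[RHS]g2|rewrite -[RHS]g1]; ring.
have O0 : oball R 2 0 by rewrite /oball /= dot0l.
move=> Op; rewrite -/(A p) -/(B p).
(* At the origin [s] and [u] do not determine [A] and [B], but the gradient of
   [u] is (B, - A) there. *)
have [p0|p0] := eqVneq p 0.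
  have [] := gu p Op; rewrite p0 !mxE !mul0r subr0 addr0 add0r addr0.
  by move=> -> ->.
have sp : s p = 0.
  rewrite (@sgrad0_segment _ s 0 p); first by rewrite /s !mxE !mul0r addr0.
  by move=> t th; apply: ds; exact: oball_segment.
have up : u p = 0 by exact/u0/oball_cball.
have pp : dot p p != 0 by rewrite dot_eq0.
have ppE : dot p p = p 0 0 * p 0 0 + p 0 1 * p 0 1.
  by rewrite /dot !big_ord_recl big_ord0 addr0; congr (_ + p _ _ * p _ _); exact/val_inj.
split; apply: (mulfI pp); rewrite mulr0 ppE.
  rewrite (_ : _ * A p = p 0 0 * s p - p 0 1 * u p); last by rewrite /s /u; ring.
  by rewrite sp up !mulr0 subr0.
rewrite (_ : _ * B p = p 0 1 * s p + p 0 0 * u p); last by rewrite /s /u; ring.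
by rewrite sp up !mulr0 addr0.
Qed.

End MinimalLagrangian.

(** * Lagrangian frames *)

Section Frames.
Variable R : realType.

(** A square matrix whose rows are orthogonal and of equal length has columns of
the same kind. *)
Lemma orthogonal_frame n (e : 'I_n -> 'rV[R]_n) (l : R) (v : 'rV[R]_n) :
  (forall i j, dot (e i) (e j) = l *+ (i == j)) -> l != 0 ->
  l *: v = \sum_i dot v (e i) *: e i.
Proof.
move=> ee l0; pose M : 'M[R]_n := \matrix_i e i.
have MM : (l^-1 *: M) *m M^T = 1%:M.
  apply/matrixP => i j; rewrite -scalemxAl !mxE.
  rewrite (_ : \sum_k _ = dot (e i) (e j)); last by apply: eq_bigr => k _; rewrite !mxE.
  by rewrite ee; case: eqP => _; rewrite ?mulr0// mulVf.
have := congr1 (fun A => l *: (v *m A)) (mulmx1C MM).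
rewrite mulmx1 -!scalemxAr scalerA mulfV// scale1r mulmxA => <-.
rewrite mulmx_sum_row; apply: eq_bigr => i _; rewrite rowK; congr (_ *: _).
by rewrite !mxE; apply: eq_bigr => k _; rewrite !mxE.
Qed.

Implicit Types u v w : 'rV[R]_(2 + 2).

Lemma dot_Jstd u v : dot (Jstd u) (Jstd v) = dot u v.
Proof.
rewrite /dot !big_split_ord /= addrC; congr (_ + _); apply: eq_bigr => i _.
  by rewrite !row_mxEr !mxE.
by rewrite !row_mxEl !mxE mulrNN.
Qed.

(** A Lagrangian plane is its own symplectic complement, because [x], [y] and
their images under [Jstd] form an orthogonal frame. The formula also holds in
the degenerate case [l = 0], where [x] and [y] vanish. *)
Lemma lagrangian_frame (x y v : 'rV[R]_(2 + 2)) (l : R) :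
  dot x x = l -> dot y y = l -> dot x y = 0 -> omega0 x y = 0 ->
  omega0 x v = 0 -> omega0 y v = 0 ->
  l *: v = dot v x *: x + dot v y *: y.
Proof.
move=> xx yy xy wxy wxv wyv.
have [l0|l0] := eqVneq l 0.
  have [x0 y0] : x = 0 /\ y = 0 by split; apply/eqP; rewrite -dot_eq0 ?xx ?yy l0.
  by rewrite l0 x0 y0 scale0r !scaler0 addr0.
pose e (i : 'I_(2 + 2)) := nth 0 [:: x; y; Jstd x; Jstd y] i.
have Jxy : dot x (Jstd y) = 0 by rewrite dotC -omega0E omega0C wxy oppr0.
have Jx z : dot z (Jstd z) = 0 by rewrite dotC -omega0E omega0vv.
have Jyx : dot y (Jstd x) = 0 by rewrite dotC -omega0E.
have yx : dot y x = 0 by rewrite dotC.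
rewrite (@orthogonal_frame _ e) //; last first.
  case=> [[|[|[|[|]]]]]// ? [[|[|[|[|]]]]]// ?;
    rewrite /e /= ?dot_Jstd ?xx ?yy ?xy ?yx ?Jx ?Jxy ?Jyx//;
    by rewrite dotC ?Jx ?Jxy ?Jyx.
rewrite !big_ord_recl big_ord0 /e /= [dot v (Jstd x)]dotC [dot v (Jstd y)]dotC.
by rewrite -!omega0E wxv wyv !scale0r !addr0.
Qed.

End Frames.

(** * Minimal Lagrangian cones *)

Section ConeIsPlanar.
Variables (R : realType) (F X Y XX XY Z W : 'rV[R]_2 -> 'rV[R]_(2 + 2)).
Hypothesis jet : harmonic_jet (oball R 2) F X Y XX XY Z W.
Hypothesis lag : forall p, oball R 2 p -> omega0 (X p) (Y p) = 0.
Hypothesis cone : forall p, oball R 2 p ->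
  omega0 (F p) (X p) = 0 /\ omega0 (F p) (Y p) = 0.
Hypothesis confXY : forall p, oball R 2 p -> dot (X p) (Y p) = 0.
Hypothesis confYY : forall p, oball R 2 p -> dot (Y p) (Y p) = dot (X p) (X p).

(** The tangent plane being its own symplectic complement, the hypothesis [cone]
puts the position vector in it. *)
Lemma cone_tangent p : oball R 2 p ->
  dot (X p) (X p) *: F p = dot (F p) (X p) *: X p + dot (F p) (Y p) *: Y p.
Proof.
move=> Op; have [FX FY] := cone Op.
by apply: lagrangian_frame; rewrite ?confYY ?confXY ?lag//
  omega0C ?FX ?FY oppr0.
Qed.

Lemma cone_second p : oball R 2 p ->
  omega0 (F p) (XX p) = 0 /\ omega0 (F p) (XY p) = 0.
Proof.
move=> Op; have FX : \forall q \near p, omega0 (F q) (X q) = 0.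
  by apply: filterS (near_oball Op) => q /cone[].
have [] := sgrad_near_cst FX (sgrad_omega0 (jet1 jet Op) (jetX jet Op)).
by rewrite omega0vv add0r => ->; rewrite omega0C lag// oppr0 add0r => ->.
Qed.

(** Where the position vector is a non-zero combination a X + b Y, pairing it with
the second derivatives gives a linear system for the two components P and Q of
the cubic form, of determinant a^2 + b^2 up to sign. Where it vanishes,
differentiating [cone_second] gives P = Q = 0 directly, and at a branch point
X = 0. *)
Lemma cone_cubic_form p : oball R 2 p ->
  omega0 (X p) (XX p) = 0 /\ omega0 (X p) (XY p) = 0.
Proof.
move=> Op.
have nxx : \forall q \near p, omega0 (F q) (XX q) = 0.
  by apply: filterS (near_oball Op) => q /cone_second[].
have [CX CY] := cone_second Op.
have [L1 L2] := lagrangian_jet jet lag Op.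
have [] := sgrad_near_cst nxx (sgrad_omega0 (jet1 jet Op) (jetXX jet Op)).
rewrite L1.
have [->|F0] := eqVneq (F p) 0.
  by rewrite !omega00l !addr0.
move=> _ _; have [X0|X0] := eqVneq (dot (X p) (X p)) 0.
  have -> : X p = 0 by apply/eqP; rewrite -dot_eq0 X0.
  by rewrite !omega00l.
have T := cone_tangent Op.
have := congr1 (fun z => omega0 z (XX p)) T; have := congr1 (fun z => omega0 z (XY p)) T.
rewrite !omega0Dl !omega0Zl CX CY !mulr0 L1 L2.
have : dot (F p) (X p) ^+ 2 + dot (F p) (Y p) ^+ 2 != 0.
  apply: contraNN F0; rewrite paddr_eq0 ?sqr_ge0// !sqrf_eq0 => /andP[/eqP a0 /eqP b0].
  by move: T; rewrite a0 b0 !scale0r addr0 => /eqP; rewrite scaler_eq0 (negbTE X0).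
move: (dot (F p) (X p)) (dot (F p) (Y p)) (omega0 (X p) (XX p)) (omega0 (X p) (XY p)).
move=> a b P Q ab E1 E2.
split; apply: (mulfI ab); rewrite mulr0.
  have -> : (a ^+ 2 + b ^+ 2) * P = a * (a * P + b * Q) - b * (a * Q + b * - P) by ring.
  by rewrite -E1 -E2 !mulr0 subr0.
have -> : (a ^+ 2 + b ^+ 2) * Q = b * (a * P + b * Q) + a * (a * Q + b * - P) by ring.
by rewrite -E1 -E2 !mulr0 addr0.
Qed.

Lemma cone_second_tangent p : oball R 2 p ->
  dot (X p) (X p) *: XX p = dot (XX p) (X p) *: X p + dot (XX p) (Y p) *: Y p /\
  dot (X p) (X p) *: XY p = dot (XY p) (X p) *: X p + dot (XY p) (Y p) *: Y p.
Proof.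
move=> Op; have [P Q] := cone_cubic_form Op; have [L1 L2] := lagrangian_jet jet lag Op.
by split; apply: lagrangian_frame; rewrite ?confYY ?confXY ?lag// ?L1 ?L2 ?P ?oppr0.
Qed.

Variable n : 'rV[R]_(2 + 2).
Let h p := dot (X p) n * dot (X p) n + dot (Y p) n * dot (Y p) n.
Let l p := dot (X p) (X p).

(** Since the second derivatives are tangent, X - i Y satisfies
(X - i Y)' = kappa (X - i Y) for a complex factor kappa, so the squared length
of the component of X - i Y along [n] and the conformal factor [l] have the same
logarithmic derivative. *)
Lemma sgrad_normal_ratio p : oball R 2 p -> l p != 0 ->
  is_sgrad (fun q => h q * (l q)^-1) p 0 0.
Proof.
move=> Op l0.
have dl := sgrad_dot (jetX jet Op) (jetX jet Op).
have dYY := sgrad_dot (jetY jet Op) (jetY jet Op).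
have dXY := sgrad_dot (jetX jet Op) (jetY jet Op).
have dx := sgrad_dot (jetX jet Op) (grad_cst n p).
have dy := sgrad_dot (jetY jet Op) (grad_cst n p).
have dh := sgrad_add (sgrad_mul dx dx) (sgrad_mul dy dy).
have conf0 : \forall q \near p, dot (X q) (X q) - dot (Y q) (Y q) = 0.
  by apply: filterS (near_oball Op) => q Oq; rewrite confYY// subrr.
have [c1 c2] := sgrad_near_cst conf0 (sgrad_sub dl dYY).
have [T1 T2] := cone_second_tangent Op.
have E1 : l p * dot (XX p) n =
    dot (XX p) (X p) * dot (X p) n + dot (XX p) (Y p) * dot (Y p) n.
  by rewrite -!dotZl -dotDl -T1.
have E2 : l p * dot (XY p) n =
    dot (XY p) (X p) * dot (X p) n + dot (XY p) (Y p) * dot (Y p) n.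
  by rewrite -!dotZl -dotDl -T2.
have ratio0 (N H m k : R) : k != 0 -> N * k = H * m -> N / k + H * (- m / k ^+ 2) = 0.
  by move=> k0 E; rewrite (_ : N = H * m / k); [field|rewrite -E mulfK].
move: c1 c2; rewrite dotNl dotNr !(dotC _ (XX p)) !(dotC _ (XY p)) => c1 c2.
have da : dot (XY p) (Y p) = dot (XX p) (X p) by lra.
have cb : dot (XY p) (X p) = - dot (XX p) (Y p) by lra.
move: E1 E2; rewrite da cb => E1 E2.
apply: (sgrad_eq (sgrad_mul dh (sgrad_inv l0 dl))); apply: ratio0 => //;
  rewrite !dot0r ?dotNl !addr0 ?(dotC (X p) (XX p)) ?(dotC (X p) (XY p)) ?cb -/(l p).
  transitivity (2 * (l p * dot (XX p) n * dot (X p) n +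
    l p * dot (XY p) n * dot (Y p) n)); first by ring.
  by rewrite E1 E2 /h; ring.
transitivity (2 * (l p * dot (XY p) n * dot (X p) n -
  l p * dot (XX p) n * dot (Y p) n)); first by ring.
by rewrite E1 E2 /h; ring.
Qed.

Lemma normal_component_segment p q :
  oball R 2 p -> oball R 2 q -> dot (X p) n = 0 -> dot (Y p) n = 0 ->
  (forall t, 0 <= t <= 1 -> l (p + t *: (q - p)) != 0) ->
  dot (X q) n = 0 /\ dot (Y q) n = 0.
Proof.
move=> Op Oq xn yn lt.
have E : h q * (l q)^-1 = h p * (l p)^-1.
  apply: (@sgrad0_segment _ (fun q => h q * (l q)^-1)) => t th.
  by apply: sgrad_normal_ratio (lt t th); exact: oball_segment.
have lq : l q != 0.
  by have := lt 1; rewrite scale1r [p + _]addrC subrK; apply; rewrite ler01 lexx.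
have /eqP : h q = 0.
  by rewrite -(divfK lq (h q)) E /h xn yn !mulr0 addr0 !mul0r.
rewrite /h -!expr2 paddr_eq0 ?sqr_ge0// !sqrf_eq0 => /andP[/eqP -> /eqP ->].
by [].
Qed.

End ConeIsPlanar.

(** * Segments avoiding the branch points *)

(** Cover the set by neighbourhoods which meet it in one point each. *)
Lemma compact_isolated_finite (T : ptopologicalType) (S : set T) :
  compact S -> S `<=` isolated S -> finite_set S.
Proof.
rewrite compact_cover => cS iS.
have /choice[V HV] : forall x, exists V : set T,
    S x -> [/\ open V, V x & V `&` S `<=` [set x]].
  move=> x; have [Sx|] := pselect (S x); last by exists set0.
  have [_ [V Vx VS]] := iS x Sx.
  exists V° => _; split; first exact: open_interior.
    exact: nbhs_singleton (nbhs_interior Vx).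
  by rewrite -VS; apply: setSI; exact: interior_subset.
have [|x Sx|D' D'S cov] := cS T S V.
- by move=> i /HV[].
- by exists x => //; have [] := HV x Sx.
apply: sub_finite_set (finite_fset D') => x Sx.
have [y D'y Vyx] := cov x Sx.
have Sy : S y by exact/set_mem/D'S.
by have [_ _ /(_ x (conj Vyx Sx)) ->] := HV y Sy.
Qed.

(** Move [q] along a line transversal to [q - p]: each point of [S] lies on the
segment for at most one value of the parameter. *)
Lemma segment_avoiding_finite (R : realType) (S : set 'rV[R]_2) (p q : 'rV[R]_2) N :
  finite_set S -> ~ S p -> nbhs q N ->
  exists2 q', N q' & forall t, 0 <= t <= 1 -> ~ S (p + t *: (q' - p)).
Proof.
move=> finS Sp qN; have [qp|qp] := eqVneq q p.
  exists p => [|t _]; first by rewrite -qp; exact: nbhs_singleton.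
  by rewrite subrr scaler0 addr0.
have [d d_def] : exists d, d = q - p by exists (q - p).
pose w : 'rV[R]_2 := \row_i (if i == 0 then - d 0 1 else d 0 0).
have dE (a b : 'rV[R]_2) : dot a b = a 0 0 * b 0 0 + a 0 1 * b 0 1.
  by rewrite /dot !big_ord_recl big_ord0 addr0; congr (_ + a _ _ * b _ _); exact/val_inj.
have dw : dot w d = 0 by rewrite dE !mxE /=; ring.
have ww : dot w w = dot d d by rewrite !dE !mxE /=; ring.
have dd : dot d d != 0 by rewrite dot_eq0 d_def subr_eq0.
(* The parameters for which the moved segment meets [S]; 0 may be one of them,
   so it is removed before taking a neighbourhood of 0. *)
pose bad := (fun b => dot (b - p) w / dot (b - p) d) @` S.
have finB : finite_set (bad `\ 0) by exact/finite_setD/finite_image.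
have nB : \forall t \near (0 : R), ~ (bad `\ 0) t.
  apply: open_nbhs_nbhs; split; last by rewrite /= => -[_]; apply.
  have /accessible_finite_set_closed clo : accessible_space R.
    exact/hausdorff_accessible/Rhausdorff.
  exact: (closed_openC (clo _ finB)).
have nN : \forall t \near (0 : R), N (q + t *: w).
  have c : (q + t *: w) @[t --> (0 : R)] --> q + 0 *: w.
    by apply: cvgD; [exact: cvg_cst|apply: cvgZl; exact: cvg_id].
  by apply: c; rewrite scale0r addr0.
have nz : \forall t \near (0 : R)^', t != 0 by exact: nbhs_dnbhs_neq.
have [t [[nBt Nt] t0]] := filter_ex (filterI (filterI (nbhs_dnbhs nB) (nbhs_dnbhs nN)) nz).
exists (q + t *: w) => // s sh Ss; apply: nBt; split; last by apply/eqP.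
have [s0|s0] := eqVneq s 0; first by move: Ss; rewrite s0 scale0r addr0.
exists (p + s *: (q + t *: w - p)) => //.
rewrite /= [p + _]addrC addrK.
rewrite (_ : q + t *: w - p = d + t *: w); last by rewrite d_def addrAC.
rewrite !(dotZl, dotDl) ?(dotC d w) dw ww mulr0 addr0.
by rewrite add0r -mulf_div divff// mul1r mulfK.
Qed.

(** * The disk lies in a plane *)

Section Planarity.
Variables (R : realType) (F X Y XX XY Z W : 'rV[R]_2 -> 'rV[R]_(2 + 2)).
Hypothesis jet : harmonic_jet (oball R 2) F X Y XX XY Z W.
Hypothesis cF : forall p, cball R 2 p -> {for p, continuous F}.
Hypothesis cX : forall p, cball R 2 p -> {for p, continuous X}.
Hypothesis cY : forall p, cball R 2 p -> {for p, continuous Y}.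
Hypothesis lag : forall p, oball R 2 p -> omega0 (X p) (Y p) = 0.
Hypothesis cone : forall p, oball R 2 p ->
  omega0 (F p) (X p) = 0 /\ omega0 (F p) (Y p) = 0.
Hypothesis confXY : forall p, oball R 2 p -> dot (X p) (Y p) = 0.
Hypothesis confYY : forall p, oball R 2 p -> dot (Y p) (Y p) = dot (X p) (X p).
Hypothesis finite_branch :
  finite_set [set p | cball R 2 p /\ dot (X p) (X p) = 0].
Variable p0 : 'rV[R]_2.
Hypothesis Op0 : oball R 2 p0.
Hypothesis immersed0 : dot (X p0) (X p0) != 0.
Variable n : 'rV[R]_(2 + 2).
Hypothesis nX : dot (X p0) n = 0.
Hypothesis nY : dot (Y p0) n = 0.

Lemma near_dot_neq0 (G : 'rV[R]_2 -> 'rV[R]_(2 + 2)) p :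
  {for p, continuous G} -> dot (G p) n != 0 -> \forall q \near p, dot (G q) n != 0.
Proof.
move=> cG Gn; have c : dot (G q) n @[q --> p] --> dot (G p) n.
  by apply: cvg_dot cG _; exact: cvg_cst.
exact: cvgr_neq0 c Gn.
Qed.

(** Points joined to [p0] by a segment free of branch points are dense, so the
identity extends to every point by continuity. *)
Lemma tangent_normal_eq0 p : oball R 2 p -> dot (X p) n = 0 /\ dot (Y p) n = 0.
Proof.
move=> Op.
suff H : forall N, nbhs p N -> exists2 q, N q & dot (X q) n = 0 /\ dot (Y q) n = 0.
  split; apply/eqP; apply: contrapT => /negP Xn.
    have [q /negP Nq [E _]] := H _ (near_dot_neq0 (cX (oball_cball Op)) Xn).
    by apply: Nq; rewrite E.
  have [q /negP Nq [_ E]] := H _ (near_dot_neq0 (cY (oball_cball Op)) Xn).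
  by apply: Nq; rewrite E.
move=> N Np.
have p0S : ~ [set p | cball R 2 p /\ dot (X p) (X p) = 0] p0.
  by case=> _ /eqP; rewrite (negbTE immersed0).
have [q [Nq Oq] good] :=
  segment_avoiding_finite finite_branch p0S (filterI Np (near_oball Op)).
exists q => //; apply: (normal_component_segment jet lag cone confXY confYY Op0 Oq nX nY).
move=> t th; apply/eqP => l0; apply: (good t th); split => //.
exact/oball_cball/oball_segment.
Qed.

Lemma position_normal_eq0 p : cball R 2 p -> dot (F p) n = 0.
Proof.
have F0 : dot (F p0) n = 0.
  have /eqP := congr1 (fun v => dot v n) (cone_tangent lag cone confXY confYY Op0).
  by rewrite dotDl !dotZl nX nY !mulr0 addr0 mulf_eq0 (negbTE immersed0) => /eqP.
have FO q : oball R 2 q -> dot (F q) n = 0.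
  move=> Oq; rewrite -F0; apply: (@sgrad0_segment _ (fun q => dot (F q) n)) => t th.
  have Ot := oball_segment Op0 Oq th; have [Xn Yn] := tangent_normal_eq0 Ot.
  by apply: (sgrad_eq (sgrad_dot (jet1 jet Ot) (grad_cst n _)));
    rewrite ?Xn ?Yn dot0r addr0.
move=> Bp; apply/eqP; apply: contrapT => /negP Fn.
have [q [Oq /negP]] := closure_oball Bp (near_dot_neq0 (cF Bp) Fn).
by rewrite FO.
Qed.

End Planarity.

(** * The disk fills its plane *)

Section Surjectivity.
Variables (R : realType) (F X Y XX XY Z W : 'rV[R]_2 -> 'rV[R]_(2 + 2)).
Hypothesis jet : harmonic_jet (oball R 2) F X Y XX XY Z W.
Hypothesis cF : forall p, cball R 2 p -> {for p, continuous F}.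
Hypothesis lag : forall p, oball R 2 p -> omega0 (X p) (Y p) = 0.
Hypothesis cone : forall p, oball R 2 p ->
  omega0 (F p) (X p) = 0 /\ omega0 (F p) (Y p) = 0.
Hypothesis confXY : forall p, oball R 2 p -> dot (X p) (Y p) = 0.
Hypothesis confYY : forall p, oball R 2 p -> dot (Y p) (Y p) = dot (X p) (X p).
Hypothesis F_ball : forall p, cball R 2 p -> dot (F p) (F p) <= 1.
Hypothesis F_sphere : forall p, usphere R 2 p -> dot (F p) (F p) = 1.
Variable q : 'rV[R]_(2 + 2).
Hypothesis q_ball : dot q q <= 1.
Hypothesis q_plane : forall p, oball R 2 p -> omega0 (X p) q = 0 /\ omega0 (Y p) q = 0.
Hypothesis q_notin : forall p, cball R 2 p -> F p != q.

Let N p := 1 - dot (F p) (F p).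
Let M p := dot (F p - q) (F p - q).
Let K p := (M p)^-1.

Let M0 p : cball R 2 p -> M p != 0.
Proof. by move=> Bp; rewrite dot_eq0 subr_eq0 q_notin. Qed.

Let dG p : oball R 2 p -> is_grad (fun r => F r - q) p (X p) (Y p).
Proof.
move=> Op v; apply: (is_derive_eq (is_deriveB (jet1 jet Op v) (is_derive_cst q p v))).
by rewrite subr0.
Qed.

Let dN p : oball R 2 p -> is_sgrad N p (- 2 * dot (F p) (X p)) (- 2 * dot (F p) (Y p)).
Proof.
move=> Op.
apply: (sgrad_eq (sgrad_sub (sgrad_cst 1 p) (sgrad_dot (jet1 jet Op) (jet1 jet Op))));
  [rewrite (dotC (X p)); ring|rewrite (dotC (Y p)); ring].
Qed.

Let dK p : oball R 2 p -> is_sgrad K p (- 2 * dot (F p - q) (X p) * K p ^+ 2)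
  (- 2 * dot (F p - q) (Y p) * K p ^+ 2).
Proof.
move=> Op; have m0 := M0 (oball_cball Op).
apply: (sgrad_eq (sgrad_inv m0 (sgrad_dot (dG Op) (dG Op)))).
  by rewrite (dotC (X p)) /K exprVn; ring.
by rewrite (dotC (Y p)) /K exprVn; ring.
Qed.

Let dFX p : oball R 2 p -> is_sgrad (fun r => dot (F r) (X r)) p
  (dot (X p) (X p) + dot (F p) (XX p)) (dot (F p) (XY p)).
Proof.
move=> Op; apply: (sgrad_eq (sgrad_dot (jet1 jet Op) (jetX jet Op))) => //.
by rewrite dotC confXY// add0r.
Qed.

Let dFY p : oball R 2 p -> is_sgrad (fun r => dot (F r) (Y r)) p
  (dot (F p) (XY p)) (dot (X p) (X p) - dot (F p) (XX p)).
Proof.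
move=> Op; apply: (sgrad_eq (sgrad_dot (jet1 jet Op) (jetY jet Op))) => //.
  by rewrite confXY// add0r.
by rewrite confYY// dotNr.
Qed.

Let dGX p : oball R 2 p -> is_sgrad (fun r => dot (F r - q) (X r)) p
  (dot (X p) (X p) + dot (F p - q) (XX p)) (dot (F p - q) (XY p)).
Proof.
move=> Op; apply: (sgrad_eq (sgrad_dot (dG Op) (jetX jet Op))) => //.
by rewrite dotC confXY// add0r.
Qed.

Let dGY p : oball R 2 p -> is_sgrad (fun r => dot (F r - q) (Y r)) p
  (dot (F p - q) (XY p)) (dot (X p) (X p) - dot (F p - q) (XX p)).
Proof.
move=> Op; apply: (sgrad_eq (sgrad_dot (dG Op) (jetY jet Op))) => //.
  by rewrite confXY// add0r.
by rewrite confYY// dotNr.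
Qed.

Let k0 p := - 2 * (dot (F p) (X p) * K p + N p * (dot (F p - q) (X p) * (K p * K p))).
Let k1 p := - 2 * (dot (F p) (Y p) * K p + N p * (dot (F p - q) (Y p) * (K p * K p))).

Let dk p : oball R 2 p -> is_sgrad (fun r => N r * K r) p (k0 p) (k1 p).
Proof.
by move=> Op; apply: (sgrad_eq (sgrad_mul (dN Op) (dK Op))); rewrite /k0 /k1; ring.
Qed.

Let dk0 p (Op : oball R 2 p) := sgrad_scale (- 2)
  (sgrad_add (sgrad_mul (dFX Op) (dK Op))
    (sgrad_mul (dN Op) (sgrad_mul (dGX Op) (sgrad_mul (dK Op) (dK Op))))).
Let dk1 p (Op : oball R 2 p) := sgrad_scale (- 2)
  (sgrad_add (sgrad_mul (dFY Op) (dK Op))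
    (sgrad_mul (dN Op) (sgrad_mul (dGY Op) (sgrad_mul (dK Op) (dK Op))))).

(** Parseval's identity for the frame [X p], [Y p] of the tangent plane. *)
Lemma frame_dot p v w : oball R 2 p -> omega0 (X p) v = 0 -> omega0 (Y p) v = 0 ->
  dot v (X p) * dot w (X p) + dot v (Y p) * dot w (Y p) = dot (X p) (X p) * dot w v.
Proof.
move=> Op vX vY.
have T : dot (X p) (X p) *: v = dot v (X p) *: X p + dot v (Y p) *: Y p.
  by apply: lagrangian_frame; rewrite ?confYY ?confXY ?lag.
by have := congr1 (dot w) T; rewrite dotDr !dotZr => ->.
Qed.

(** In a complex coordinate of the plane, the quotient times 1 - |q|^2 is
|h (F)|^2 - 1 with h (w) = (1 - conj q w) / (w - q), and |h (F)|^2 is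
subharmonic since F is conformal. Without the factor 1 - |q|^2, which vanishes
when q is on the circle, the Laplacian is 4 <X, X> (1 - |q|^2) / |F - q|^4. *)
Lemma poisson_quotient_le0 p : cball R 2 p -> N p * K p <= 0.
Proof.
apply: (harmonic_maximum_principle _ dk dk0 dk1).
- apply: continuous_in_subspaceT => r /set_mem Br.
  have cG : F z - q @[z --> r] --> F r - q by apply: cvgB (cF Br) _; exact: cvg_cst.
  have cK : K z @[z --> r] --> K r by exact: cvgV (M0 Br) (cvg_dot cG cG).
  have cN : N z @[z --> r] --> N r.
    by exact: cvgB (cvg_cst (1 : R)) (cvg_dot (cF Br) (cF Br)).
  exact: cvgM cN cK.
- move=> r Or.
  have [FX FY] := cone Or; have [qX qY] := q_plane Or.
  have GX : omega0 (X r) (F r - q) = 0.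
    by rewrite omega0Dr omega0Nr qX subr0 omega0C FX oppr0.
  have GY : omega0 (Y r) (F r - q) = 0.
    by rewrite omega0Dr omega0Nr qY subr0 omega0C FY oppr0.
  have E1 := frame_dot (F r) Or GX GY.
  have E2 := frame_dot (F r - q) Or GX GY.
  have MK : M r * K r = 1 by rewrite mulfV// M0//; exact: oball_cball.
  have E3 : 2 * dot (F r) (F r - q) - M r = dot (F r) (F r) - dot q q.
    by rewrite /M !(dotDl, dotDr, dotNl, dotNr) (dotC q (F r)); ring.
  have ge0 : 0 <= 4 * dot (X r) (X r) * K r ^+ 2 * (1 - dot q q).
    by rewrite mulr_ge0 ?subr_ge0// mulr_ge0 ?sqr_ge0// mulr_ge0 ?dot_ge0.
  apply: (le_trans ge0); rewrite le_eqVlt; apply/orP; left; apply/eqP; symmetry.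
  transitivity (- 4 * dot (X r) (X r) * K r
    + 8 * (dot (F r - q) (X r) * dot (F r) (X r) +
           dot (F r - q) (Y r) * dot (F r) (Y r)) * K r ^+ 2
    - 4 * N r * dot (X r) (X r) * K r ^+ 2
    + 8 * N r * (dot (F r - q) (X r) * dot (F r - q) (X r) +
                 dot (F r - q) (Y r) * dot (F r - q) (Y r)) * K r ^+ 3); first by ring.
  rewrite E1 E2 -/(M r) (_ : 1 - dot q q = N r + (2 * dot (F r) (F r - q) - M r)); last first.
    by rewrite E3 /N; ring.
  rewrite (_ : 8 * N r * _ * K r ^+ 3 =
    8 * N r * dot (X r) (X r) * K r ^+ 2 * (M r * K r)); last by ring.
  rewrite MK (_ : - 4 * _ * K r = - 4 * dot (X r) (X r) * K r * (M r * K r));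
    last by rewrite MK mulr1.
  by ring.
- by move=> r Sr; rewrite /N F_sphere// subrr mul0r.
Qed.

(** The quotient is non-positive and its numerator non-negative, so |F| = 1 on the
disk; the Laplacian of |F|^2, which is 4 <X, X>, therefore vanishes. *)
Lemma omitted_point_degenerate p : oball R 2 p -> dot (X p) (X p) = 0.
Proof.
have N0 r : oball R 2 r -> N r = 0.
  move=> /oball_cball Br; apply/eqP; rewrite eq_le; apply/andP; split; last first.
    by rewrite subr_ge0 F_ball.
  have K0 : 0 < K r by rewrite invr_gt0 lt_neqAle eq_sym M0// dot_ge0.
  by rewrite -(pmulr_lle0 _ K0) poisson_quotient_le0.
have FXY r : oball R 2 r -> dot (F r) (X r) = 0 /\ dot (F r) (Y r) = 0.
  move=> Or; have [/eqP E1 /eqP E2] := sgrad_near_cst (filterS N0 (near_oball Or)) (dN Or).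
  by move: E1 E2; rewrite !mulf_eq0 oppr_eq0 pnatr_eq0 /= => /eqP -> /eqP ->.
move=> Op.
have [E1 _] := sgrad_near_cst (filterS (fun r Or => (FXY r Or).1) (near_oball Op)) (dFX Op).
have [_ E2] := sgrad_near_cst (filterS (fun r Or => (FXY r Or).2) (near_oball Op)) (dFY Op).
by lra.
Qed.

End Surjectivity.

(** * Flatness of the disk *)

Lemma lagrangian_plane (R : realType) (x y : 'rV[R]_(2 + 2)) :
  dot x x != 0 -> dot y y = dot x x -> dot x y = 0 -> omega0 x y = 0 ->
  \dim <<[:: x; y]>> = 2%N /\
  forall v, (v \in <<[:: x; y]>>%VS) <-> omega0 x v = 0 /\ omega0 y v = 0.
Proof.
move=> l0 yy xy wxy; split.
  have : free [:: x; y].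
    rewrite free_cons seq1_free -dot_eq0 yy l0 andbT span_seq1.
    apply/negP => /vlineP[k xk]; move: l0; rewrite {1}xk dotZl dotC xy mulr0.
    by rewrite eqxx.
  by move=> /eqP.
move=> v; split.
  rewrite span_cons span_seq1 => /memv_addP[_ /vlineP[a ->] [_ /vlineP[b ->] ->]].
  by rewrite !omega0Dr !omega0Zr !omega0vv (omega0C y) wxy oppr0 !mulr0 addr0.
move=> [xv yv]; rewrite (_ : v = (dot v x / dot x x) *: x + (dot v y / dot x x) *: y).
  by apply: memvD; apply: memvZ; apply: memv_span; rewrite !inE eqxx ?orbT.
have := congr1 (GRing.scale (dot x x)^-1) (lagrangian_frame erefl yy xy wxy xv yv).
by rewrite scalerA mulVf// scale1r scalerDr !scalerA ![_^-1 * _]mulrC.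
Qed.

Lemma legendrian_minimal_disk_planar (R : realType)
    (F X Y XX XY Z W : 'rV[R]_2 -> 'rV[R]_(2 + 2)) (p0 : 'rV[R]_2) :
  harmonic_jet (oball R 2) F X Y XX XY Z W ->
  (forall p, cball R 2 p -> [/\ {for p, continuous F}, {for p, continuous X}
     & {for p, continuous Y}]) ->
  (forall p, oball R 2 p -> omega0 (X p) (Y p) = 0) ->
  (forall p, oball R 2 p -> dot (X p) (Y p) = 0) ->
  (forall p, oball R 2 p -> dot (Y p) (Y p) = dot (X p) (X p)) ->
  (forall p, usphere R 2 p ->
     p 0 0 * omega0 (F p) (Y p) - p 0 1 * omega0 (F p) (X p) = 0) ->
  (forall p, cball R 2 p -> cball R (2 + 2) (F p)) ->
  (forall p, usphere R 2 p -> usphere R (2 + 2) (F p)) ->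
  finite_set [set p | cball R 2 p /\ dot (X p) (X p) = 0] ->
  oball R 2 p0 -> dot (X p0) (X p0) != 0 ->
  exists P : {vspace 'rV[R]_(2 + 2)},
    \dim P = 2%N /\ F @` cball R 2 = [set x | x \in P] `&` cball R (2 + 2).
Proof.
move=> jet cts lag cXY cYY leg Fball Fsphere finB Op0 l0.
have cF p (Bp : cball R 2 p) : {for p, continuous F} by have [] := cts p Bp.
have cX p (Bp : cball R 2 p) : {for p, continuous X} by have [] := cts p Bp.
have cY p (Bp : cball R 2 p) : {for p, continuous Y} by have [] := cts p Bp.
have cone := liouville_form_eq0 jet cF cX cY lag leg.
have [dimP memP] := lagrangian_plane l0 (cYY _ Op0) (cXY _ Op0) (lag _ Op0).
set x := X p0 in l0 dimP memP *; set y := Y p0 in dimP memP *.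
have dotJ u v : dot u (Jstd v) = omega0 v u by rewrite omega0E dotC.
have nor n : n \in [:: x; y] -> dot x (Jstd n) = 0 /\ dot y (Jstd n) = 0.
  rewrite !inE !dotJ => /orP[] /eqP ->; rewrite ?omega0vv ?lag//.
  by rewrite omega0C lag ?oppr0.
have xin : x \in [:: x; y] by rewrite inE eqxx.
have yin : y \in [:: x; y] by rewrite !inE eqxx orbT.
exists <<[:: x; y]>>%VS; split=> //; apply/seteqP; split=> [_ [p Bp <-]|q [/= qP qB]].
  split; last exact: Fball.
  apply/memP; rewrite -!dotJ.
  have FP n : n \in [:: x; y] -> dot (F p) (Jstd n) = 0.
    move=> /nor[n1 n2].
    exact: (position_normal_eq0 jet cF cX cY lag cone cXY cYY finB Op0 l0 n1 n2 Bp).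
  by split; exact: FP.
apply: contrapT => Fq.
have [xq yq] := (memP q).1 qP.
have qE : dot x x *: q = dot q x *: x + dot q y *: y.
  by apply: lagrangian_frame => //; [exact: cYY|exact: cXY|exact: lag].
have T p n : oball R 2 p -> n \in [:: x; y] -> omega0 (X p) n = 0 /\ omega0 (Y p) n = 0.
  move=> Op /nor[n1 n2].
  have [Xn Yn] := tangent_normal_eq0 jet cX cY lag cone cXY cYY finB Op0 l0 n1 n2 Op.
  by rewrite (omega0C (X p)) (omega0C (Y p)) -!dotJ Xn Yn oppr0.
apply: (elimN eqP l0).
apply: (omitted_point_degenerate jet cF lag cone cXY cYY Fball Fsphere qB) Op0 => [p Op|p Bp].
  have [Xx Yx] := T p x Op xin; have [Xy Yy] := T p y Op yin.
  have H v : omega0 v x = 0 -> omega0 v y = 0 -> omega0 v q = 0.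
    move=> vx vy; have := congr1 (omega0 v) qE.
    rewrite omega0Dr !omega0Zr vx vy !mulr0 addr0 => /eqP.
    by rewrite mulf_eq0 (negbTE l0) => /eqP.
  by split; exact: H.
by apply/eqP => E; apply: Fq; exists p.
Qed.

(** This yields an immersed point inside the disk, since branch points are
isolated. *)
Lemma isolated_not_oball (R : realType) (S : set 'rV[R]_2) :
  S `<=` isolated S -> exists2 p, oball R 2 p & ~ S p.
Proof.
move=> iS; apply: contrapT => H.
have OS p : oball R 2 p -> S p.
  by move=> Op; apply: contrapT => Sp; apply: H; exists p.
have O0 : oball R 2 0 by rewrite /oball /= dot0l.
have [_ [N N0 NS]] := iS 0 (OS 0 O0).
pose e : 'rV[R]_2 := delta_mx 0 0.
have near0 : \forall t \near (0 : R), (N `&` oball R 2) (t *: e).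
  have c : t *: e @[t --> (0 : R)] --> 0 *: e by apply: cvgZl; exact: cvg_id.
  by apply: c; rewrite scale0r; apply: filterI => //; exact: near_oball.
have nz : \forall t \near (0 : R)^', t != 0 by exact: nbhs_dnbhs_neq.
have [t [[Nt Ot] t0]] := filter_ex (filterI (nbhs_dnbhs near0) nz).
have : (N `&` S) (t *: e) by split=> //; exact: OS.
rewrite NS => /= /(congr1 (fun v : 'rV[R]_2 => v 0 0)).
by rewrite !mxE /= mulr1 => /eqP; rewrite (negbTE t0).
Qed.

(** Passing from the map, whose values off the closed disk are arbitrary, to the
derivatives of a smooth extension. *)
Lemma harmonic_disk_jet (R : realType) (m : nat) (f : 'rV[R]_2 -> 'rV[R]_m.+1) :
  smooth_up_to_boundary f -> Defs.harmonic f ->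
  exists F X Y XX XY Z W : 'rV[R]_2 -> 'rV[R]_m.+1,
  [/\ harmonic_jet (oball R 2) F X Y XX XY Z W,
    forall p, cball R 2 p -> F p = f p,
    forall p, cball R 2 p -> [/\ {for p, continuous F}, {for p, continuous X}
      & {for p, continuous Y}] &
    forall p v, cball R 2 p -> tangent_map f p v = v 0 0 *: X p + v 0 1 *: Y p].
Proof.
move=> [U [F [openU BU smF Ff]]] harm.
have harmF p : oball R 2 p -> partial 0 (partial 0 F) p + partial 1 (partial 1 F) p = 0.
  move=> Op.
  have E1 i q : oball R 2 q -> partial i f q = partial i F q.
    move=> Oq; have nE : \forall r \near q, f r = F r.
      by apply: filterS (near_oball Oq) => r /oball_cball/Ff.
    exact: (@partial_near R m i f F q nE).
  have E2 i : partial i (partial i f) p = partial i (partial i F) p.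
    exact: (@partial_near R m i _ _ p (filterS (E1 i) (near_oball Op))).
  have sum2 (g : 'I_2 -> 'rV[R]_m.+1) : \sum_(i < 2) g i = g 0 + g 1.
    by rewrite !big_ord_recl big_ord0 addr0; congr (_ + g _); exact/val_inj.
  apply: etrans (congr2 +%R (esym (E2 0)) (esym (E2 1))) _.
  exact: etrans (esym (sum2 (fun i => partial i (partial i f) p))) (harm p Op).
exists F, (partial 0 F), (partial 1 F), (partial 0 (partial 0 F)), (partial 1 (partial 0 F)),
  (partial 0 (partial 0 (partial 0 F))), (partial 1 (partial 0 (partial 0 F))); split.
- exact: harmonic_jet_smooth openU BU smF harmF.
- exact: Ff.
- move=> p Bp; split.
  + by have := @continuous_smooth R m U F smF [::] p (BU p Bp); apply.
  + by have := @continuous_smooth R m U F smF [:: 0] p (BU p Bp); apply.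
  + by have := @continuous_smooth R m U F smF [:: 1] p (BU p Bp); apply.
- by move=> p v Bp; exact: (@tangent_mapE R m U f F BU smF Ff p v Bp).
Qed.

Theorem theorem1p1 (R : realType) (iota : 'rV[R]_2 -> 'rV[R]_(2 + 2))
    (iota_ball : forall p, cball R 2 p -> cball R (2 + 2) (iota p))
    (iota_minimal : branched_minimal_immersion iota)
    (iota_lagrangian : lagrangian iota)
    (iota_sphere : forall p, usphere R 2 p -> usphere R (2 + 2) (iota p))
    (iota_capillary : legendrian_capillary_boundary iota) :
  exists P : {vspace 'rV[R]_(2 + 2)},
    \dim P = 2%N /\
    iota @` cball R 2 = [set x | x \in P] `&` cball R (2 + 2).
Proof.
have [smooth _ conf harm iso] := iota_minimal.
have [leg _] := iota_capillary.
have [F [X [Y [XX [XY [Z [W [jet Ff cts tm]]]]]]]] := harmonic_disk_jet smooth harm.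
have SB p : usphere R 2 p -> cball R 2 p by move=> Sp; rewrite /cball /= [dot _ _]Sp.
pose e0 : 'rV[R]_2 := delta_mx 0 0; pose e1 : 'rV[R]_2 := delta_mx 0 1.
have tm0 p : cball R 2 p -> tangent_map iota p e0 = X p.
  by move=> Bp; rewrite (tm p e0 Bp) !mxE /= scale1r scale0r addr0.
have tm1 p : cball R 2 p -> tangent_map iota p e1 = Y p.
  by move=> Bp; rewrite (tm p e1 Bp) !mxE /= scale1r scale0r add0r.
have cXY p : cball R 2 p -> dot (X p) (Y p) = 0 /\ dot (Y p) (Y p) = dot (X p) (X p).
  move=> Bp; have [l _ Hl] := conf p Bp.
  have := Hl e0 e0; have := Hl e0 e1; have := Hl e1 e1.
  by rewrite (tm0 p Bp) (tm1 p Bp) !dot_deltal !mxE /= mulr0 => -> -> ->.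
have immP p : cball R 2 p -> immersed_at iota p <-> dot (X p) (X p) != 0.
  move=> Bp; have [xy yy] := cXY p Bp; split=> [inj|l0 v w].
    apply/eqP => l0.
    have X0 : X p = 0 by apply/eqP; rewrite -dot_eq0 l0.
    have : e0 = 0.
      by apply: inj; rewrite (tm0 p Bp) (tm p 0 Bp) X0 !mxE !scale0r addr0.
    by move=> /(congr1 (fun v : 'rV[R]_2 => v 0 0)) /eqP; rewrite !mxE /= oner_eq0.
  rewrite (tm p v Bp) (tm p w Bp) => E.
  have E0 := congr1 (dot (X p)) E; have E1 := congr1 (dot (Y p)) E.
  move: E0 E1; rewrite !dotDr !dotZr (dotC (Y p) (X p)) xy yy !mulr0 !addr0 !add0r.
  by move=> /(mulIf l0) E0 /(mulIf l0) E1; rewrite [v]rV2E [w]rV2E E0 E1.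
have branchE : branch_points iota = [set p | cball R 2 p /\ dot (X p) (X p) = 0].
  apply/seteqP; split=> p [Bp H]; split => //.
    by apply/eqP; apply: contrapT => /negP/(immP p Bp).
  by move=> /(immP p Bp); rewrite H eqxx.
have finB : finite_set [set p | cball R 2 p /\ dot (X p) (X p) = 0].
  rewrite -branchE; apply: compact_isolated_finite => //; rewrite branchE.
  apply: subclosed_compact (@compact_cball R 2) _ => [p Sp|p []//].
  have Bp : cball R 2 p.
    by apply: (@closed_cball R 2 p) => N /Sp[q [[Bq _] Nq]]; exists q.
  split => //; apply/eqP; apply: contrapT => /negP l0.
  have cl : dot (X q) (X q) @[q --> p] --> dot (X p) (X p).
    by have [_ Xp _] := cts p Bp; exact: (cvg_dot Xp Xp).
  have nz : \forall q \near p, dot (X q) (X q) != 0 by exact: cvgr_neq0 cl l0.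
  have [q [[_ ql0] /negP]] := Sp _ nz.
  by rewrite ql0.
have [p0 Op0 Sp0] := isolated_not_oball iso.
have -> : iota @` cball R 2 = F @` cball R 2.
  by apply/seteqP; split=> _ [p Bp <-]; exists p => //; rewrite Ff.
apply: (legendrian_minimal_disk_planar jet cts) (finB) (Op0) _ => [p Op|p Op|p Op|p Sp|p Bp|p Sp|].
- have Bp := oball_cball Op.
  by have := iota_lagrangian p e0 e1 Bp; rewrite (tm0 p Bp) (tm1 p Bp).
- by have [] := cXY p (oball_cball Op).
- by have [] := cXY p (oball_cball Op).
- have Bp := SB p Sp; have [l0|l0] := eqVneq (dot (X p) (X p)) 0.
    have [_ yy] := cXY p Bp.
    have X0 : X p = 0 by apply/eqP; rewrite -dot_eq0 l0.
    have Y0 : Y p = 0 by apply/eqP; rewrite -dot_eq0 yy l0.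
    by rewrite X0 Y0 !(omega0C (F p)) !omega00l oppr0 !mulr0 subr0.
  (* [v] is the rotation field, tangent to the circle. *)
  pose v : 'rV[R]_2 := p 0 0 *: e1 - p 0 1 *: e0.
  have v0 : v 0 0 = - p 0 1 by rewrite !mxE /= mulr0 mulr1 add0r.
  have v1 : v 0 1 = p 0 0 by rewrite !mxE /= mulr0 mulr1 subr0.
  have pv : dot p v = 0.
    by rewrite dotDr dotNr !dotZr !(dotC p) !dot_deltal mulrC subrr.
  have := leg p v Sp ((immP p Bp).2 l0) pv.
  by rewrite (tm p v Bp) -Ff// -omega0E omega0Dr !omega0Zr v0 v1 mulNr addrC.
- by rewrite Ff//; exact: iota_ball.
- by rewrite Ff; [exact: iota_sphere|exact: SB].
- apply/eqP => l0; apply: Sp0; rewrite branchE; split; last exact: l0.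
  exact: (oball_cball Op0).
Qed.
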